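(* The quotient $\mathcal A/\mathcal J$ is an infinite-dimensional, purely infinite Banach $*$-algebra; that is, it is not a division algebra, and for every non-zero $a\in\mathcal A/\mathcal J$ there exist $b,c\in\mathcal A/\mathcal J$ with $bac=1_{\mathcal A/\mathcal J}$.
   Context: Let $\mathrm{Cu}_2$ be the involutive monoid with identity $e$ and zero element $\lozenge$ (so $\lozenge t=\lozenge=t\lozenge$ for all $t$), generated by $s_1,s_2,s_1^*,s_2^*$ subject to $s_1^*s_1=e=s_2^*s_2$ and $s_1^*s_2=\lozenge=s_2^*s_1$, with involution $t\mapsto t^*$ satisfying $(t^* )^*=t$, $(tu)^*=u^*t^*$. Let $\mathcal A=\ell^1(\mathrm{Cu}_2\setminus\{\lozenge\})$ with product $\#$ determined by bilinearity and continuity from $\delta_s\#\delta_t=\delta_{st}$ if $st\neq\lozenge$ and $\delta_s\#\delta_t=0$ if $st=\lozenge$; this is a unital Banach $*$-algebra with unit $\delta_e$ and isometric involution $f^*(s)=\overline{f(s^* )}$. Let $f_0=\delta_e-\delta_{s_1s_1^*}-\delta_{s_2s_2^*}$ and let $\mathcal J$ be the closed two-sided ideal of $\mathcal A$ generated by $f_0$ (a $*$-ideal); $\mathcal A/\mathcal J$ carries the quotient norm and involution. *)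

(* Defs.v *)
From Stdlib Require Import Reals List ClassicalEpsilon.
From Coquelicot Require Import Coquelicot.
Import ListNotations.

(* The Cuntz monoid Cu_2.                                               *)
(* Every non-zero element of Cu_2 has a unique normal form             *)
(*   s_mu s_nu^star  with mu, nu words in the generators {s_1, s_2}       *)
(* (s_mu = s_{m1} ... s_{mk}, s_nu^star = s_{nk}^star ... s_{n1}^star).          *)
(* We represent a word as a list bool (false = 1, true = 2) and the    *)
(* non-zero element s_mu s_nu^star by the pair (mu, nu).  The zero        *)
(* element (lozenge) is represented by None in products.               *)

Definition Word := list bool.
Definition Cu := (Word * Word)%type.   (* Cu_2 \ {lozenge} *)

Definition Cu_eq_dec (x y : Cu) : {x = y} + {x <> y}.
Proof. repeat decide equality. Defined.

Fixpoint strip_prefix (p w : Word) : option Word :=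
  match p, w with
  | [], _ => Some w
  | a :: p', b :: w' => if Bool.bool_dec a b then strip_prefix p' w' else None
  | _ :: _, [] => None
  end.

(* (s_mu s_nu^star)(s_al s_be^star) :
     = s_{mu g} s_be^star   if al = nu g,
     = s_mu s_{be g}^star   if nu = al g,
     = lozenge           otherwise. *)
Definition cu_mul (x y : Cu) : option Cu :=
  let (mu, nu) := x in let (al, be) := y in
  match strip_prefix nu al with
  | Some g => Some (mu ++ g, be)
  | None =>
    match strip_prefix al nu with
    | Some g => Some (mu, be ++ g)
    | None => None
    end
  end.

Definition cu_star (x : Cu) : Cu := (snd x, fst x).

Definition cu_e : Cu := ([], []).
Definition cu_s1s1s : Cu := ([false], [false]).
Definition cu_s2s2s : Cu := ([true], [true]).

Definition Afun := Cu -> C.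

Fixpoint finsum {X : Type} (F : X -> C) (l : list X) : C :=
  match l with [] => RtoC 0 | x :: l' => Cplus (F x) (finsum F l') end.

Fixpoint finsumR {X : Type} (F : X -> R) (l : list X) : R :=
  match l with [] => 0%R | x :: l' => (F x + finsumR F l')%R end.

Definition is_l1 (f : Afun) : Prop :=
  exists M : R, forall l : list Cu, NoDup l -> (finsumR (fun x => Cmod (f x)) l <= M)%R.

Definition has_sum {X : Type} (F : X -> C) (c : C) : Prop :=
  forall eps : R, (0 < eps)%R ->
    exists l0 : list X, forall l : list X, NoDup l -> incl l0 l ->
      (Cmod (Cminus (finsum F l) c) < eps)%R.

Definition f_zero : Afun := fun _ => RtoC 0.
Definition f_add (f g : Afun) : Afun := fun t => Cplus (f t) (g t).
Definition f_sub (f g : Afun) : Afun := fun t => Cminus (f t) (g t).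
Definition f_scale (a : C) (f : Afun) : Afun := fun t => Cmult a (f t).
Definition delta (s : Cu) : Afun := fun t => if Cu_eq_dec s t then RtoC 1 else RtoC 0.

(* The product #: bilinear continuous extension of
   delta_s # delta_t = delta_{st} (st <> lozenge), 0 (st = lozenge), i.e.
   (f # g)(t) = sum over pairs (s,u) with s u = t of f(s) g(u). *)
Definition conv_term (f g : Afun) (t : Cu) (p : Cu * Cu) : C :=
  match cu_mul (fst p) (snd p) with
  | Some t' => if Cu_eq_dec t' t then Cmult (f (fst p)) (g (snd p)) else RtoC 0
  | None => RtoC 0
  end.

Definition conv (f g : Afun) : Afun :=
  fun t => epsilon (inhabits (RtoC 0)) (fun c => has_sum (conv_term f g t) c).

Definition unit_A : Afun := delta cu_e.

Definition l1_dist_lt (f g : Afun) (eps : R) : Prop :=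
  exists M : R, (M < eps)%R /\
    forall l : list Cu, NoDup l ->
      (finsumR (fun x => Cmod (Cminus (f x) (g x))) l <= M)%R.

Definition closed_ideal (I : Afun -> Prop) : Prop :=
  (forall f, I f -> is_l1 f) /\
  I f_zero /\
  (forall f g, I f -> I g -> I (f_add f g)) /\
  (forall a f, I f -> I (f_scale a f)) /\
  (forall f g, I f -> is_l1 g -> I (conv g f) /\ I (conv f g)) /\
  (forall f, is_l1 f -> (forall eps, (0 < eps)%R -> exists g, I g /\ l1_dist_lt f g eps) -> I f).

Definition f0 : Afun := f_sub (f_sub (delta cu_e) (delta cu_s1s1s)) (delta cu_s2s2s).

Definition J (f : Afun) : Prop := forall I, closed_ideal I -> I f0 -> I f.

Fixpoint lincomb (n : nat) (c : nat -> C) (F : nat -> Afun) : Afun :=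
  match n with
  | O => f_zero
  | S m => f_add (lincomb m c F) (f_scale (c m) (F m))
  end.

(* Main.v *)
(** Write a pair p = (sigma, tau) for s_sigma s_tau^star, p w for (sigma w, tau w), and 1 for
    the letter [false].  For q = (mu, nu) let Phi_q(f) be the sum of f(p) over all p such
    that q 1^n = p w for some n and w: this evaluates f at a point of the Cuntz groupoid.
    Whenever p is counted, so is exactly one of p 1 and p 2; hence Phi_q vanishes on all
    translates p - p 1 - p 2 of f_0, and on J.

    If Phi_q(a) <> 0 for some q, then the compressions of a by s_{mu 1^n 2}^star on the left
    and s_{nu 1^n 2} on the right converge in norm to Phi_q(a) delta_e: the final letter 2
    kills every off-diagonal term once n is large.  A Neumann series turns a compression
    close to a nonzero scalar into a factorisation b a c = 1, which even holds in A.

    If Phi_q(a) = 0 for all q, then a is in J.  Modulo J the mass of a at levels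
    max(|mu|, |nu|) < n can be pushed to level n by the relation p = p 1 + p 2; the mass
    which then sits at a q of level n equals minus the sum of a(q 1^j) over j > 0, so its
    total is bounded by the tail of a beyond level n. *)

Require Import Defs.
From Stdlib Require Import Reals List ClassicalEpsilon Permutation Lra Lia FunctionalExtensionality.
From Coquelicot Require Import Coquelicot.
Import ListNotations.
Local Open Scope R_scope.

(** * Unconditional sums *)

(** Membership is decided classically, so that no decidable equality on [X] has to be supplied. *)
Lemma nodup_ex {X : Type} (l : list X) :
  exists l', NoDup l' /\ forall x, In x l' <-> In x l.
Proof.
  induction l as [|x l [l' [Hn Hi]]].
  - exists []; split; [constructor | tauto].
  - destruct (classic (In x l')) as [Hx|Hx].
    + exists l'; split; [easy|]. intro y; simpl; rewrite Hi.
      split; [tauto|]. intros [<-|H]; [now apply Hi|easy].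
    + exists (x :: l'); split; [now constructor|]. intro y; simpl; now rewrite Hi.
Qed.

Lemma incl_perm {X : Type} (l0 l : list X) :
  NoDup l0 -> incl l0 l -> exists l', Permutation l (l0 ++ l').
Proof.
  revert l; induction l0 as [|x l0 IH]; intros l Hn Hi.
  - now exists l.
  - inversion Hn as [|? ? Hx Hn']; subst.
    destruct (in_split x l) as [l1 [l2 ->]]; [apply Hi; now left|].
    destruct (IH (l1 ++ l2) Hn') as [l' Hp].
    + intros y Hy. specialize (Hi y (or_intror Hy)).
      apply in_app_iff in Hi; apply in_app_iff; simpl in Hi.
      destruct Hi as [?|[->|?]]; tauto.
    + exists l'. simpl. rewrite <- Hp. symmetry; apply Permutation_middle.
Qed.

Lemma finsumR_app {X : Type} (u : X -> R) l l' :
  finsumR u (l ++ l') = finsumR u l + finsumR u l'.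
Proof. induction l as [|x l IH]; simpl; [|rewrite IH]; ring. Qed.

Lemma finsum_perm {X : Type} (F : X -> C) l l' :
  Permutation l l' -> finsum F l = finsum F l'.
Proof.
  induction 1; simpl; [easy | now f_equal | ring | congruence].
Qed.

Lemma finsumR_perm {X : Type} (u : X -> R) l l' :
  Permutation l l' -> finsumR u l = finsumR u l'.
Proof.
  induction 1; simpl; [easy | now f_equal | ring | congruence].
Qed.

Lemma finsumR_ge0 {X : Type} (u : X -> R) l : (forall x, 0 <= u x) -> 0 <= finsumR u l.
Proof.
  intro Hu; induction l as [|x l IH]; simpl; [lra|]. specialize (Hu x); lra.
Qed.

Lemma finsumR_le {X : Type} (u v : X -> R) l :
  (forall x, In x l -> u x <= v x) -> finsumR u l <= finsumR v l.
Proof.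
  induction l as [|x l IH]; simpl; intro H; [lra|].
  assert (u x <= v x) by auto. assert (finsumR u l <= finsumR v l) by auto. lra.
Qed.

Lemma finsumR_plus {X : Type} (u v : X -> R) l :
  finsumR (fun x => u x + v x) l = finsumR u l + finsumR v l.
Proof. induction l as [|x l IH]; simpl; [|rewrite IH]; ring. Qed.

Lemma finsumR_scal {X : Type} (a : R) (u : X -> R) l :
  finsumR (fun x => a * u x) l = a * finsumR u l.
Proof. induction l as [|x l IH]; simpl; [|rewrite IH]; ring. Qed.

Lemma finsumR_const {X : Type} (a : R) (l : list X) :
  finsumR (fun _ => a) l = a * INR (length l).
Proof.
  induction l as [|x l IH]; [simpl; ring|].
  change (length (x :: l)) with (S (length l)). rewrite S_INR; simpl. rewrite IH; ring.
Qed.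

Lemma finsumR_swap {X Y : Type} (u : X -> Y -> R) l l' :
  finsumR (fun x => finsumR (u x) l') l = finsumR (fun y => finsumR (fun x => u x y) l) l'.
Proof.
  induction l as [|x l IH]; simpl.
  - induction l' as [|y l' IH]; simpl; [easy|]. rewrite <- IH; ring.
  - now rewrite IH, <- finsumR_plus.
Qed.

Lemma finsumR_list_prod {X Y : Type} (u : X -> R) (v : Y -> R) l l' :
  finsumR (fun p => u (fst p) * v (snd p)) (list_prod l l') = finsumR u l * finsumR v l'.
Proof.
  induction l as [|x l IH]; simpl; [ring|].
  rewrite finsumR_app, IH. rewrite Rmult_plus_distr_r; f_equal.
  clear IH; induction l' as [|y l' IH]; simpl; [ring|]. rewrite IH; ring.
Qed.

Lemma finsumR_incl {X : Type} (u : X -> R) l0 l :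
  (forall x, 0 <= u x) -> NoDup l0 -> incl l0 l -> finsumR u l0 <= finsumR u l.
Proof.
  intros Hu Hn Hi. destruct (incl_perm l0 l Hn Hi) as [l' Hp].
  rewrite (finsumR_perm u _ _ Hp), finsumR_app.
  pose proof (finsumR_ge0 u l' Hu); lra.
Qed.

Lemma Cmod_finsum_le {X : Type} (F : X -> C) l :
  Cmod (finsum F l) <= finsumR (fun x => Cmod (F x)) l.
Proof.
  induction l as [|x l IH]; simpl; [rewrite Cmod_0; lra|].
  eapply Rle_trans; [apply Cmod_triangle|lra].
Qed.

Lemma finsum_plus {X : Type} (F G : X -> C) l :
  finsum (fun x => F x + G x)%C l = (finsum F l + finsum G l)%C.
Proof. induction l as [|x l IH]; simpl; [|rewrite IH]; ring. Qed.

Lemma finsum_scal {X : Type} (a : C) (F : X -> C) l :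
  finsum (fun x => a * F x)%C l = (a * finsum F l)%C.
Proof. induction l as [|x l IH]; simpl; [|rewrite IH]; ring. Qed.

Lemma finsum_zero {X : Type} (F : X -> C) l :
  (forall x, In x l -> F x = 0%C) -> finsum F l = 0%C.
Proof.
  induction l as [|x l IH]; simpl; intro H; [easy|].
  rewrite (H x (or_introl eq_refl)), IH; [ring|]. intros y Hy; apply H; now right.
Qed.

(** Norms enter only through upper bounds on finite partial sums; [is_l1 f] is convertible with
    [exists M, l1_le f M]. *)
Definition l1_le {X : Type} (F : X -> C) (M : R) : Prop :=
  forall l, NoDup l -> finsumR (fun x => Cmod (F x)) l <= M.

Lemma l1_le_ge0 {X : Type} (F : X -> C) M : l1_le F M -> 0 <= M.
Proof. intro H. apply (H [] (NoDup_nil _)). Qed.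

Lemma l1_le_pt {X : Type} (F : X -> C) M x : l1_le F M -> Cmod (F x) <= M.
Proof.
  intro H. specialize (H [x]); simpl in H.
  rewrite Rplus_0_r in H; apply H. repeat constructor; auto.
Qed.

Lemma l1_le_weaken {X : Type} (F : X -> C) M M' : l1_le F M -> M <= M' -> l1_le F M'.
Proof. intros H HM l Hl. specialize (H l Hl); lra. Qed.

Lemma l1_le_dom {X : Type} (F G : X -> C) M :
  (forall x, Cmod (F x) <= Cmod (G x)) -> l1_le G M -> l1_le F M.
Proof.
  intros H HG l Hl. eapply Rle_trans; [apply finsumR_le; intros; apply H | now apply HG].
Qed.

Lemma l1_le_plus {X : Type} (F G : X -> C) M N :
  l1_le F M -> l1_le G N -> l1_le (fun x => F x + G x)%C (M + N).
Proof.
  intros HF HG l Hl. specialize (HF l Hl); specialize (HG l Hl).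
  eapply Rle_trans; [|apply Rplus_le_compat; eassumption].
  rewrite <- finsumR_plus. apply finsumR_le; intros; apply Cmod_triangle.
Qed.

Lemma l1_le_scal {X : Type} (a : C) (F : X -> C) M :
  l1_le F M -> l1_le (fun x => a * F x)%C (Cmod a * M).
Proof.
  intros HF l Hl. specialize (HF l Hl).
  replace (finsumR _ l) with (Cmod a * finsumR (fun x => Cmod (F x)) l).
  - apply Rmult_le_compat_l; [apply Cmod_ge_0|easy].
  - rewrite <- finsumR_scal. f_equal. extensionality x. now rewrite Cmod_mult.
Qed.

Lemma l1_le_zero {X : Type} : l1_le (fun _ : X => RtoC 0) 0.
Proof. intros l _. rewrite Cmod_0, finsumR_const; lra. Qed.

Lemma l1_le_single {X : Type} (F : X -> C) x M :
  (forall y, y <> x -> F y = 0%C) -> Cmod (F x) <= M -> l1_le F M.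
Proof.
  intros H HM l Hl. pose proof (Cmod_ge_0 (F x)).
  assert (Hz : forall l', ~ In x l' -> finsumR (fun y => Cmod (F y)) l' = 0).
  { induction l' as [|y l' IH]; simpl; intro Hx; [easy|].
    rewrite H, Cmod_0, IH; [ring|tauto|]. intro; subst; tauto. }
  destruct (classic (In x l)) as [Hx|Hx]; [|rewrite Hz; auto; lra].
  destruct (in_split _ _ Hx) as [l1 [l2 ->]].
  rewrite <- (finsumR_perm _ _ _ (Permutation_middle l1 l2 x)); simpl.
  rewrite Hz; [lra|]. now apply NoDup_remove_2.
Qed.

(** A finite set of pairs lies in the product of its two projections, and over that product the
    double sum factors. *)
Lemma l1_le_tensor {X Y : Type} (F : X -> C) (G : Y -> C) M N :
  l1_le F M -> l1_le G N -> l1_le (fun p => F (fst p) * G (snd p))%C (M * N).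
Proof.
  intros HF HG l Hl.
  destruct (nodup_ex (map fst l)) as [l1 [Hn1 Hi1]].
  destruct (nodup_ex (map snd l)) as [l2 [Hn2 Hi2]].
  apply Rle_trans with (finsumR (fun p => Cmod (F (fst p)) * Cmod (G (snd p))) (list_prod l1 l2)).
  - replace (fun p => Cmod (F (fst p) * G (snd p))) with
      (fun p : X * Y => Cmod (F (fst p)) * Cmod (G (snd p)))
      by (extensionality p; now rewrite Cmod_mult).
    apply finsumR_incl; [|easy|].
    + intro p; apply Rmult_le_pos; apply Cmod_ge_0.
    + intros [x y] Hxy. apply in_prod; [apply Hi1 | apply Hi2];
        [change x with (fst (x, y)) | change y with (snd (x, y))]; now apply in_map.
  - rewrite (finsumR_list_prod (fun x => Cmod (F x)) (fun y => Cmod (G y))).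
    apply Rmult_le_compat; auto; apply finsumR_ge0; intro; apply Cmod_ge_0.
Qed.

Lemma has_sum_unique {X : Type} (F : X -> C) c c' : has_sum F c -> has_sum F c' -> c = c'.
Proof.
  intros H H'. apply Ceq_minus, Cmod_eq_0.
  apply Rle_antisym; [|apply Cmod_ge_0]. apply Rle_plus_epsilon; intros eps He.
  destruct (H (eps / 2)) as [l1 H1]; [lra|]. destruct (H' (eps / 2)) as [l2 H2]; [lra|].
  destruct (nodup_ex (l1 ++ l2)) as [l [Hn Hi]].
  specialize (H1 l Hn); specialize (H2 l Hn).
  lapply H1; [clear H1; intro H1 | intros y Hy; apply Hi, in_app_iff; auto].
  lapply H2; [clear H2; intro H2 | intros y Hy; apply Hi, in_app_iff; auto].
  replace (c - c')%C with ((finsum F l - c') + - (finsum F l - c))%C by ring.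
  eapply Rle_trans; [apply Cmod_triangle|]. rewrite Cmod_opp; lra.
Qed.

Lemma has_sum_ext {X : Type} (F G : X -> C) c :
  (forall x, F x = G x) -> has_sum F c -> has_sum G c.
Proof. intros H. now replace G with F by now extensionality x. Qed.

Lemma has_sum_plus {X : Type} (F G : X -> C) c d :
  has_sum F c -> has_sum G d -> has_sum (fun x => F x + G x)%C (c + d)%C.
Proof.
  intros H H' eps He.
  destruct (H (eps / 2)) as [l1 H1]; [lra|]. destruct (H' (eps / 2)) as [l2 H2]; [lra|].
  exists (l1 ++ l2); intros l Hn Hi. apply incl_app_inv in Hi as [Hi1 Hi2].
  specialize (H1 l Hn Hi1); specialize (H2 l Hn Hi2). rewrite finsum_plus.
  replace (_ - _)%C with ((finsum F l - c) + (finsum G l - d))%C by ring.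
  eapply Rle_lt_trans; [apply Cmod_triangle|lra].
Qed.

Lemma has_sum_scal {X : Type} (a : C) (F : X -> C) c :
  has_sum F c -> has_sum (fun x => a * F x)%C (a * c)%C.
Proof.
  intros H eps He. pose proof (Cmod_ge_0 a).
  destruct (H (eps / (Cmod a + 1))) as [l1 H1]; [apply Rdiv_lt_0_compat; lra|].
  exists l1; intros l Hn Hi. specialize (H1 l Hn Hi). rewrite finsum_scal.
  replace (_ - _)%C with (a * (finsum F l - c))%C by ring. rewrite Cmod_mult.
  apply Rle_lt_trans with ((Cmod a) * (eps / (Cmod a + 1))).
  - apply Rmult_le_compat_l; lra.
  - apply Rlt_le_trans with ((Cmod a + 1) * (eps / (Cmod a + 1))).
    + apply Rmult_lt_compat_r; [apply Rdiv_lt_0_compat; lra|lra].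
    + right; field; lra.
Qed.

Lemma has_sum_bound {X : Type} (F : X -> C) c M : has_sum F c -> l1_le F M -> Cmod c <= M.
Proof.
  intros H HM. apply Rle_plus_epsilon; intros eps He.
  destruct (H eps He) as [l0 H0]. destruct (nodup_ex l0) as [l [Hn Hi]].
  specialize (H0 l Hn). lapply H0; [clear H0; intro H0 | intros y Hy; now apply Hi].
  replace c with (finsum F l + - (finsum F l - c))%C by ring.
  eapply Rle_trans; [apply Cmod_triangle|]. rewrite Cmod_opp.
  pose proof (Cmod_finsum_le F l); pose proof (HM l Hn); lra.
Qed.

Lemma has_sum_single {X : Type} (F : X -> C) x :
  (forall y, y <> x -> F y = 0%C) -> has_sum F (F x).
Proof.
  intros H eps He. exists [x]; intros l Hn Hi.
  destruct (incl_perm [x] l) as [l' Hp]; [repeat constructor; auto | easy|].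
  pose proof (Permutation_NoDup Hp Hn) as Hn'. rewrite (finsum_perm F _ _ Hp); simpl.
  rewrite finsum_zero; [replace (_ - _)%C with (RtoC 0) by ring; now rewrite Cmod_0|].
  intros y Hy; apply H; intro; subst. inversion Hn'; auto.
Qed.

Lemma sum_lub {X : Type} (u : X -> R) M :
  (forall x, 0 <= u x) -> (forall l, NoDup l -> finsumR u l <= M) ->
  exists m, (forall l, NoDup l -> finsumR u l <= m) /\
    forall eps, 0 < eps -> exists l, NoDup l /\ m - eps < finsumR u l.
Proof.
  intros Hu HM.
  destruct (completeness (fun r => exists l, NoDup l /\ r = finsumR u l)) as [m [Hm1 Hm2]].
  - exists M; intros r [l [Hl ->]]; auto.
  - exists 0, []; split; [constructor|easy].
  - exists m; split.
    + intros l Hl; apply Hm1; now exists l.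
    + intros eps He. apply NNPP; intro Hno.
      assert (m <= m - eps); [|lra]. apply Hm2. intros r [l [Hl ->]].
      apply Rnot_lt_le; intro; apply Hno; now exists l.
Qed.

Lemma RtoC_finsum {X : Type} (u : X -> R) l :
  finsum (fun x => RtoC (u x)) l = RtoC (finsumR u l).
Proof. induction l as [|x l IH]; simpl; [easy|]. now rewrite IH, RtoC_plus. Qed.

Lemma has_sum_pos_ex {X : Type} (u : X -> R) M :
  (forall x, 0 <= u x) -> (forall l, NoDup l -> finsumR u l <= M) ->
  exists c, has_sum (fun x => RtoC (u x)) c.
Proof.
  intros Hu HM. destruct (sum_lub u M Hu HM) as [m [H1 H2]].
  exists (RtoC m); intros eps He. destruct (H2 eps He) as [l0 [Hn0 H0]].
  exists l0; intros l Hn Hi. rewrite RtoC_finsum, <- RtoC_minus, Cmod_R.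
  pose proof (finsumR_incl u l0 l Hu Hn0 Hi). pose proof (H1 l Hn).
  rewrite Rabs_left1; lra.
Qed.

(** The positive and negative parts of [Re (F x)] and [Im (F x)] are four nonnegative families
    dominated by [Cmod (F x)]; each sums to the supremum of its partial sums. *)
Lemma has_sum_ex {X : Type} (F : X -> C) M : l1_le F M -> exists c, has_sum F c.
Proof.
  intro HM.
  assert (Hpos : forall u : X -> R, (forall x, Rabs (u x) <= Cmod (F x)) ->
            exists c, has_sum (fun x => RtoC (Rmax (u x) 0)) c).
  { intros u Hu. apply has_sum_pos_ex with M; [intro; apply Rmax_r|].
    intros l Hl. eapply Rle_trans; [|apply (HM l Hl)].
    apply finsumR_le; intros x _. specialize (Hu x).
    pose proof (Rle_abs (u x)); pose proof (Rabs_pos (u x)). apply Rmax_lub; lra. }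
  assert (Hre : forall x, Rabs (Re (F x)) <= Cmod (F x) /\ Rabs (Im (F x)) <= Cmod (F x)).
  { intro x. pose proof (Rmax_Cmod (F x)). unfold Re, Im.
    pose proof (Rmax_l (Rabs (fst (F x))) (Rabs (snd (F x)))).
    pose proof (Rmax_r (Rabs (fst (F x))) (Rabs (snd (F x)))). lra. }
  destruct (Hpos (fun x => Re (F x))) as [c1 H1]; [intro; apply Hre|].
  destruct (Hpos (fun x => - Re (F x))) as [c2 H2]; [intro; rewrite Rabs_Ropp; apply Hre|].
  destruct (Hpos (fun x => Im (F x))) as [c3 H3]; [intro; apply Hre|].
  destruct (Hpos (fun x => - Im (F x))) as [c4 H4]; [intro; rewrite Rabs_Ropp; apply Hre|].
  apply (has_sum_scal (- (1))%C) in H2. apply (has_sum_scal (- Ci)%C) in H4.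
  apply (has_sum_scal Ci) in H3.
  pose proof (has_sum_plus _ _ _ _ (has_sum_plus _ _ _ _ H1 H2) (has_sum_plus _ _ _ _ H3 H4)) as H.
  eexists. replace F with (fun x => RtoC (Rmax (Re (F x)) 0) + - (1) * RtoC (Rmax (- Re (F x)) 0)
     + (Ci * RtoC (Rmax (Im (F x)) 0) + - Ci * RtoC (Rmax (- Im (F x)) 0)))%C; [exact H|].
  assert (Hm : forall r, Rmax r 0 - Rmax (- r) 0 = r).
  { intro r. unfold Rmax; repeat destruct Rle_dec; lra. }
  extensionality x. transitivity (RtoC (Re (F x)) + Ci * RtoC (Im (F x)))%C.
  - rewrite <- (Hm (Re (F x))) at 3. rewrite <- (Hm (Im (F x))) at 3.
    rewrite !RtoC_minus. ring.
  - destruct (F x) as [r i]. apply injective_projections; simpl; ring.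
Qed.

(** The same choice as in [conv], which makes [conv f g t] convertible with
    [Sum (conv_term f g t)]. *)
Definition Sum {X : Type} (F : X -> C) : C := epsilon (inhabits (RtoC 0)) (has_sum F).

Lemma Sum_spec {X : Type} (F : X -> C) M : l1_le F M -> has_sum F (Sum F).
Proof. intro H. unfold Sum. apply epsilon_spec. now apply has_sum_ex with M. Qed.

Lemma Sum_eq {X : Type} (F : X -> C) c : has_sum F c -> Sum F = c.
Proof.
  intro H. apply has_sum_unique with F; [|easy]. unfold Sum. apply epsilon_spec. now exists c.
Qed.

(** A matrix whose columns have norm at most 1 is a contraction of l1: exchange the two finite sums.
    This gives both the norm bound for convolution and the estimate of one level by the levels
    beyond it. *)
Lemma kernel_l1_le {X T : Type} (K : T -> X -> C) (F : X -> C) (S : T -> C) M :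
  l1_le F M -> (forall x, l1_le (fun t => K t x) 1) ->
  (forall t, has_sum (fun x => K t x * F x)%C (S t)) -> l1_le S M.
Proof.
  intros HF HK HS l Hl. apply Rle_plus_epsilon; intros eps He.
  pose proof (pos_INR (length l)).
  (* Each of the [length l] values [S t] is approximated within [e]; the [+ 1] covers the empty
     list. *)
  set (e := eps / (INR (length l) + 1)).
  assert (He' : 0 < e) by (apply Rdiv_lt_0_compat; lra).
  (* Since [l] is finite, one index set [l0] serves all of its rows at once. *)
  assert (Hu : exists l0, forall l', NoDup l' -> incl l0 l' -> forall t, In t l ->
            Cmod (finsum (fun x => K t x * F x)%C l' - S t) < e).
  { clear Hl H. clearbody e. induction l as [|t l [l0 IH]].
    - exists []; intros ? ? ? ? [].
    - destruct (HS t e He') as [l1 H1]. exists (l1 ++ l0).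
      intros l' Hn Hi s Hs. apply incl_app_inv in Hi as [Hi1 Hi2].
      destruct Hs as [<-|Hs]; auto. }
  destruct Hu as [l0 H0]. destruct (nodup_ex l0) as [l' [Hn Hi]].
  specialize (H0 l' Hn). lapply H0; [clear H0; intro H0 | intros y Hy; now apply Hi].
  apply Rle_trans with
    (finsumR (fun t => finsumR (fun x => Cmod (K t x) * Cmod (F x)) l' + e) l).
  - apply finsumR_le; intros t Ht. specialize (H0 t Ht).
    pose proof (Cmod_finsum_le (fun x => K t x * F x)%C l') as Hc.
    cbv beta in Hc.
    replace (fun x => Cmod (K t x * F x)) with (fun x => Cmod (K t x) * Cmod (F x)) in Hc
      by (extensionality x; now rewrite Cmod_mult).
    set (A := finsum (fun x => K t x * F x)%C l') in *.
    replace (S t) with (A + - (A - S t))%C by ring.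
    eapply Rle_trans; [apply Cmod_triangle|]. rewrite Cmod_opp. lra.
  - rewrite finsumR_plus, finsumR_const, finsumR_swap. apply Rplus_le_compat.
    + eapply Rle_trans; [|apply (HF l' Hn)]. apply finsumR_le; intros x _.
      apply Rle_trans with (Cmod (F x) * 1); [|lra].
      replace (fun t => Cmod (K t x) * Cmod (F x)) with (fun t => Cmod (F x) * Cmod (K t x))
        by (extensionality t; ring).
      rewrite finsumR_scal. apply Rmult_le_compat_l; [apply Cmod_ge_0|]. now apply HK.
    + replace eps with (e * (INR (length l) + 1)) by (unfold e; field; lra).
      apply Rmult_le_compat_l; lra.
Qed.

(** * The algebra *)

Lemma is_l1_add f g : is_l1 f -> is_l1 g -> is_l1 (f_add f g).
Proof. intros [M HM] [N HN]; exists (M + N). exact (l1_le_plus f g M N HM HN). Qed.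

Lemma is_l1_scale a f : is_l1 f -> is_l1 (f_scale a f).
Proof. intros [M HM]; exists (Cmod a * M). exact (l1_le_scal a f M HM). Qed.

Lemma l1_le_delta s : l1_le (delta s) 1.
Proof.
  apply l1_le_single with s.
  - intros y Hy; unfold delta; destruct Cu_eq_dec; congruence.
  - unfold delta; destruct Cu_eq_dec; [rewrite Cmod_1; lra | congruence].
Qed.

Lemma is_l1_delta s : is_l1 (delta s).
Proof. exists 1; apply l1_le_delta. Qed.

Lemma is_l1_zero : is_l1 f_zero.
Proof. exists 0; apply l1_le_zero. Qed.

Lemma f_sub_add f g : f_sub f g = f_add f (f_scale (- (1))%C g).
Proof. extensionality t; unfold f_sub, f_add, f_scale; ring. Qed.

Lemma is_l1_sub f g : is_l1 f -> is_l1 g -> is_l1 (f_sub f g).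
Proof. intros; rewrite f_sub_add; apply is_l1_add, is_l1_scale; auto. Qed.

Lemma f_sub_diag f : f_sub f f = f_zero.
Proof. extensionality t; unfold f_sub, f_zero; ring. Qed.

Lemma l1_le_sub_triangle f g h M N :
  l1_le (f_sub f g) M -> l1_le (f_sub g h) N -> l1_le (f_sub f h) (M + N).
Proof.
  intros H1 H2. replace (f_sub f h) with (fun t => f_sub f g t + f_sub g h t)%C.
  - now apply l1_le_plus.
  - extensionality t; unfold f_sub; ring.
Qed.

Lemma l1_le_sub_sym f g M : l1_le (f_sub f g) M -> l1_le (f_sub g f) M.
Proof.
  apply l1_le_dom; intro t. rewrite <- Cmod_opp. right; f_equal; unfold f_sub; ring.
Qed.

Lemma l1_le_0_eq f g : (forall eps, 0 < eps -> l1_le (f_sub f g) eps) -> f = g.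
Proof.
  intro H. extensionality t. apply Ceq_minus, Cmod_eq_0, Rle_antisym; [|apply Cmod_ge_0].
  apply Rle_plus_epsilon; intros eps He. rewrite Rplus_0_l.
  exact (l1_le_pt _ _ t (H eps He)).
Qed.

(** Presents the product as a 0/1 matrix applied to the tensor of f and g. Column [p] has at most
    one nonzero entry, at the product of the pair, as [kernel_l1_le] requires. *)
Definition conv_kernel (t : Cu) (p : Cu * Cu) : C :=
  match cu_mul (fst p) (snd p) with
  | Some t' => if Cu_eq_dec t' t then RtoC 1 else RtoC 0
  | None => RtoC 0
  end.

Lemma conv_term_kernel f g t :
  conv_term f g t = fun p => (conv_kernel t p * (f (fst p) * g (snd p)))%C.
Proof.
  extensionality p; unfold conv_term, conv_kernel.
  destruct cu_mul as [t'|]; [destruct Cu_eq_dec|]; ring.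
Qed.

Lemma conv_kernel_le_1 t p : Cmod (conv_kernel t p) <= 1.
Proof.
  unfold conv_kernel; destruct cu_mul as [t'|]; [destruct Cu_eq_dec|];
    rewrite ?Cmod_0, ?Cmod_1; lra.
Qed.

Lemma conv_spec f g t : is_l1 f -> is_l1 g -> has_sum (conv_term f g t) (conv f g t).
Proof.
  intros [M HM] [N HN]. apply (Sum_spec (conv_term f g t) (M * N)).
  eapply l1_le_dom; [|apply (l1_le_tensor f g M N HM HN)].
  intro p; rewrite conv_term_kernel, Cmod_mult. pose proof (conv_kernel_le_1 t p).
  pose proof (Cmod_ge_0 (f (fst p) * g (snd p))).
  rewrite <- (Rmult_1_l (Cmod (f (fst p) * g (snd p)))) at 2.
  now apply Rmult_le_compat_r.
Qed.

Lemma l1_le_conv f g M N : l1_le f M -> l1_le g N -> l1_le (conv f g) (M * N).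
Proof.
  intros HM HN. apply (kernel_l1_le conv_kernel (fun p => f (fst p) * g (snd p))%C).
  - now apply l1_le_tensor.
  - intro p. destruct (cu_mul (fst p) (snd p)) as [t|] eqn:E.
    + apply l1_le_single with t; [|apply conv_kernel_le_1].
      intros y Hy; unfold conv_kernel; rewrite E; destruct Cu_eq_dec; congruence.
    + eapply l1_le_weaken; [|apply Rle_0_1].
      eapply l1_le_dom; [|apply l1_le_zero]. intro t; unfold conv_kernel; rewrite E; lra.
  - intro t. rewrite <- conv_term_kernel. apply conv_spec; [now exists M | now exists N].
Qed.

Lemma is_l1_conv f g : is_l1 f -> is_l1 g -> is_l1 (conv f g).
Proof. intros [M HM] [N HN]; exists (M * N); now apply l1_le_conv. Qed.

Lemma conv_delta s t :
  conv (delta s) (delta t) = match cu_mul s t with Some r => delta r | None => f_zero end.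
Proof.
  extensionality u. apply (has_sum_unique (conv_term (delta s) (delta t) u)).
  - apply conv_spec; apply is_l1_delta.
  - replace (match cu_mul s t with Some r => delta r | None => f_zero end u)
      with (conv_term (delta s) (delta t) u (s, t)).
    + apply has_sum_single. intros [x y] Hxy. rewrite conv_term_kernel; simpl.
      unfold delta. destruct (Cu_eq_dec s x), (Cu_eq_dec t y); try ring. congruence.
    + unfold conv_term; simpl. destruct cu_mul as [r|]; [|easy].
      unfold delta. destruct (Cu_eq_dec s s), (Cu_eq_dec t t), (Cu_eq_dec r u);
        try congruence; ring.
Qed.

(** Linearity is asked for on l1 arguments only: elsewhere the sums behind [conv] may diverge, and
    [epsilon] then returns an unspecified value. *)
Record bounded_op (T : Afun -> Afun) (K : R) : Prop := {
  bop_add : forall f g, is_l1 f -> is_l1 g -> T (f_add f g) = f_add (T f) (T g);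
  bop_scale : forall a f, is_l1 f -> T (f_scale a f) = f_scale a (T f);
  bop_le : forall f M, l1_le f M -> l1_le (T f) (K * M) }.

Lemma bop_sub T K f g :
  bounded_op T K -> is_l1 f -> is_l1 g -> T (f_sub f g) = f_sub (T f) (T g).
Proof.
  intros HT Hf Hg. rewrite !f_sub_add, (bop_add _ _ HT), (bop_scale _ _ HT); auto.
  now apply is_l1_scale.
Qed.

Lemma bop_zero T K : bounded_op T K -> T f_zero = f_zero.
Proof.
  intro HT. rewrite <- (f_sub_diag f_zero) at 1.
  rewrite (bop_sub _ _ _ _ HT); [apply f_sub_diag| |]; apply is_l1_zero.
Qed.

Lemma bop_l1 T K f : bounded_op T K -> is_l1 f -> is_l1 (T f).
Proof. intros HT [M HM]; exists (K * M); now apply (bop_le _ _ HT). Qed.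

Lemma bop_comp T T' K K' :
  bounded_op T K -> bounded_op T' K' -> bounded_op (fun f => T (T' f)) (K * K').
Proof.
  intros HT HT'; split.
  - intros f g Hf Hg. rewrite (bop_add _ _ HT'); auto.
    apply (bop_add _ _ HT); now apply (bop_l1 _ _ _ HT').
  - intros a f Hf. rewrite (bop_scale _ _ HT'); auto.
    apply (bop_scale _ _ HT); now apply (bop_l1 _ _ _ HT').
  - intros f M HM. rewrite Rmult_assoc. now apply (bop_le _ _ HT), (bop_le _ _ HT').
Qed.

Lemma bop_conv_r f M : l1_le f M -> bounded_op (conv f) M.
Proof.
  intro HM. assert (Hf : is_l1 f) by now exists M. split.
  - intros g h Hg Hh. extensionality t.
    apply (has_sum_unique (conv_term f (f_add g h) t)); [apply conv_spec; auto; now apply is_l1_add|].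
    pose proof (has_sum_plus _ _ _ _ (conv_spec f g t Hf Hg) (conv_spec f h t Hf Hh)) as H.
    rewrite !conv_term_kernel in *.
    refine (has_sum_ext _ _ _ _ H); intro p; cbv beta; unfold f_add; ring.
  - intros a g Hg. extensionality t.
    apply (has_sum_unique (conv_term f (f_scale a g) t)); [apply conv_spec; auto; now apply is_l1_scale|].
    pose proof (has_sum_scal a _ _ (conv_spec f g t Hf Hg)) as H.
    rewrite !conv_term_kernel in *.
    refine (has_sum_ext _ _ _ _ H); intro p; cbv beta; unfold f_scale; ring.
  - intros g N HN. now apply l1_le_conv.
Qed.

Lemma bop_conv_l g N : l1_le g N -> bounded_op (fun f => conv f g) N.
Proof.
  intro HN. assert (Hg : is_l1 g) by now exists N. split.
  - intros f h Hf Hh. extensionality t.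
    apply (has_sum_unique (conv_term (f_add f h) g t)); [apply conv_spec; auto; now apply is_l1_add|].
    pose proof (has_sum_plus _ _ _ _ (conv_spec f g t Hf Hg) (conv_spec h g t Hh Hg)) as H.
    rewrite !conv_term_kernel in *.
    refine (has_sum_ext _ _ _ _ H); intro p; cbv beta; unfold f_add; ring.
  - intros a f Hf. extensionality t.
    apply (has_sum_unique (conv_term (f_scale a f) g t)); [apply conv_spec; auto; now apply is_l1_scale|].
    pose proof (has_sum_scal a _ _ (conv_spec f g t Hf Hg)) as H.
    rewrite !conv_term_kernel in *.
    refine (has_sum_ext _ _ _ _ H); intro p; cbv beta; unfold f_scale; ring.
  - intros f M HM. rewrite Rmult_comm. now apply l1_le_conv.
Qed.

(** * Density of the finitely supported functions *)

Fixpoint comb (l : list Cu) (f : Afun) : Afun :=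
  match l with
  | [] => f_zero
  | x :: l' => f_add (f_scale (f x) (delta x)) (comb l' f)
  end.

Lemma comb_eval l f t :
  NoDup l -> comb l f t = if in_dec Cu_eq_dec t l then f t else RtoC 0.
Proof.
  induction l as [|x l IH]; intro Hn; [easy|]. inversion Hn as [|? ? Hx Hn']; subst.
  simpl comb. unfold f_add, f_scale, delta. rewrite (IH Hn').
  destruct (in_dec Cu_eq_dec t (x :: l)) as [H|H], (in_dec Cu_eq_dec t l) as [H'|H'],
    (Cu_eq_dec x t) as [E|E]; subst; simpl in *; try ring; tauto.
Qed.

(** Once a finite set carries all but eps of the supremum of the partial sums, any finite set
    disjoint from it carries at most eps. *)
Lemma l1_tail f eps :
  is_l1 f -> 0 < eps -> exists l, NoDup l /\ l1_le (f_sub f (comb l f)) eps.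
Proof.
  intros [M HM] He.
  destruct (sum_lub (fun x => Cmod (f x)) M) as [m [H1 H2]]; [intro; apply Cmod_ge_0 | exact HM|].
  destruct (H2 eps He) as [l0 [Hn0 H0]]. exists l0; split; [easy|]. intros l Hl.
  set (out := fun x => if in_dec Cu_eq_dec x l0 then false else true).
  assert (Hs : finsumR (fun x => Cmod (f_sub f (comb l0 f) x)) l =
               finsumR (fun x => Cmod (f x)) (filter out l)).
  { clear Hl. induction l as [|x l IH]; simpl; [easy|]. rewrite IH.
    unfold f_sub at 1. rewrite comb_eval by easy. unfold out at 2.
    destruct in_dec; simpl.
    - replace (f x - f x)%C with (RtoC 0) by ring. rewrite Cmod_0; ring.
    - now replace (f x - 0)%C with (f x) by ring. }
  rewrite Hs. assert (Hn : NoDup (l0 ++ filter out l)).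
  { apply NoDup_app; [easy | now apply NoDup_filter|].
    intros x Hx Hx'. apply filter_In in Hx' as [_ Hx']. unfold out in Hx'.
    destruct in_dec; easy. }
  apply H1 in Hn. rewrite finsumR_app in Hn. lra.
Qed.

Lemma l1_density (P : Afun -> Prop) :
  (forall s, P (delta s)) ->
  (forall f g, is_l1 f -> is_l1 g -> P f -> P g -> P (f_add f g)) ->
  (forall a f, is_l1 f -> P f -> P (f_scale a f)) ->
  (forall f, is_l1 f ->
     (forall eps, 0 < eps -> exists g, is_l1 g /\ P g /\ l1_le (f_sub f g) eps) -> P f) ->
  forall f, is_l1 f -> P f.
Proof.
  intros Hd Ha Hs Hc f Hf. apply Hc; [easy|]. intros eps He.
  destruct (l1_tail f eps Hf He) as [l [_ Hl]]. exists (comb l f).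
  assert (H : is_l1 (comb l f) /\ P (comb l f)); [|tauto].
  clear Hl. induction l as [|x l [IH1 IH2]]; simpl.
  - split; [apply is_l1_zero|].
    (* The zero function falls under the closure hypotheses as a multiple of a delta. *)
    replace f_zero with (f_scale 0%C (delta cu_e)) by (extensionality t; unfold f_scale, f_zero; ring).
    apply Hs; auto; apply is_l1_delta.
  - assert (is_l1 (f_scale (f x) (delta x))) by apply is_l1_scale, is_l1_delta.
    split; [now apply is_l1_add|]. apply Ha; auto. apply Hs; auto. apply is_l1_delta.
Qed.

Lemma bop_eq_closed T T' K K' f :
  bounded_op T K -> bounded_op T' K' -> is_l1 f ->
  (forall eps, 0 < eps -> exists g, is_l1 g /\ T g = T' g /\ l1_le (f_sub f g) eps) ->
  T f = T' f.
Proof.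
  intros HT HT' Hf H. apply l1_le_0_eq; intros eps He.
  (* An operator bound is nonnegative because it bounds the norm of the image of a delta. *)
  assert (HK : 0 <= K) by (pose proof (l1_le_ge0 _ _ (bop_le _ _ HT _ _ (l1_le_delta cu_e))); lra).
  assert (HK' : 0 <= K') by (pose proof (l1_le_ge0 _ _ (bop_le _ _ HT' _ _ (l1_le_delta cu_e))); lra).
  destruct (H (eps / (K + K' + 1))) as [g [Hg [Eg Hfg]]]; [apply Rdiv_lt_0_compat; lra|].
  set (e := eps / (K + K' + 1)) in *.
  assert (He' : 0 < e) by (apply Rdiv_lt_0_compat; lra).
  apply l1_le_weaken with (K * e + K' * e).
  - apply l1_le_sub_triangle with (T g).
    + rewrite <- (bop_sub _ _ _ _ HT Hf Hg). now apply (bop_le _ _ HT).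
    + rewrite Eg. apply l1_le_sub_sym. rewrite <- (bop_sub _ _ _ _ HT' Hf Hg).
      now apply (bop_le _ _ HT').
  - replace eps with ((K + K' + 1) * e) by (unfold e; field; lra).
    replace (K * e + K' * e) with ((K + K') * e) by ring. apply Rmult_le_compat_r; lra.
Qed.

Lemma bop_ext T T' K K' :
  bounded_op T K -> bounded_op T' K' -> (forall s, T (delta s) = T' (delta s)) ->
  forall f, is_l1 f -> T f = T' f.
Proof.
  intros HT HT' Hd. apply l1_density; [easy| | |].
  - intros f g Hf Hg Ef Eg. rewrite (bop_add _ _ HT), (bop_add _ _ HT'); congruence.
  - intros a f Hf Ef. rewrite (bop_scale _ _ HT), (bop_scale _ _ HT'); congruence.
  - intros f Hf H. exact (bop_eq_closed _ _ _ _ f HT HT' Hf H).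
Qed.

(** * The Cuntz monoid acting on words; associativity and unit of the product *)

Lemma strip_prefix_spec p w g : strip_prefix p w = Some g <-> w = p ++ g.
Proof.
  revert w; induction p as [|a p IH]; intros w; simpl.
  - split; congruence.
  - destruct w as [|b w]; [split; discriminate|].
    destruct Bool.bool_dec as [<-|Hab].
    + rewrite IH. split; congruence.
    + split; [discriminate|]. intro; congruence.
Qed.

Lemma strip_prefix_app p w : strip_prefix p (p ++ w) = Some w.
Proof. now apply strip_prefix_spec. Qed.

(** Either [nu] ends inside [al], or [al] is used up first and the rest of [nu] must be cancelled
    from [z]. *)
Lemma strip_prefix_long nu al z :
  strip_prefix nu (al ++ z) =
  match strip_prefix nu al with
  | Some g => Some (g ++ z)
  | None => match strip_prefix al nu with Some g => strip_prefix g z | None => None end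
  end.
Proof.
  revert nu; induction al as [|a al IH]; intros [|b nu]; simpl; try easy.
  destruct (Bool.bool_dec b a), (Bool.bool_dec a b); subst; try congruence. apply IH.
Qed.

Lemma strip_prefix_cat be g w :
  strip_prefix (be ++ g) w =
  match strip_prefix be w with Some z => strip_prefix g z | None => None end.
Proof.
  revert w; induction be as [|b be IH]; intros [|a w]; simpl; try easy.
  destruct Bool.bool_dec; [apply IH|easy].
Qed.

(* The faithful action of Cu_2 on finite words by partial injections, nu z |-> mu z. *)
Definition act (s : Cu) (w : Word) : option Word :=
  match strip_prefix (snd s) w with Some z => Some (fst s ++ z) | None => None end.

Definition act_opt (s : option Cu) (w : Word) : option Word :=
  match s with Some s => act s w | None => None end.

Lemma act_mul s t w :
  act_opt (cu_mul s t) w = match act t w with Some w' => act s w' | None => None end.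
Proof.
  destruct s as [mu nu], t as [al be]; unfold act_opt, act; simpl.
  destruct (strip_prefix be w) as [z|] eqn:Ez; simpl.
  - rewrite strip_prefix_long.
    destruct (strip_prefix nu al) as [g|]; simpl.
    + now rewrite Ez, app_assoc.
    + destruct (strip_prefix al nu) as [g|]; simpl; [|easy].
      now rewrite strip_prefix_cat, Ez.
  - destruct (strip_prefix nu al) as [g|]; simpl; [now rewrite Ez|].
    destruct (strip_prefix al nu) as [g|]; simpl; [|easy].
    now rewrite strip_prefix_cat, Ez.
Qed.

(** The element (mu, nu) sends nu to mu and is defined only on extensions of nu. If (al, be) acts
    alike, nu and be are prefixes of each other, hence equal, and so are their images. *)
Lemma act_faithful s t : (forall w, act_opt s w = act_opt t w) -> s = t.
Proof.
  assert (Hs : forall mu nu, act (mu, nu) nu = Some mu).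
  { intros mu nu; unfold act; simpl. rewrite <- (app_nil_r nu) at 2.
    now rewrite strip_prefix_app, app_nil_r. }
  assert (Hd : forall mu nu w w', act (mu, nu) w = Some w' -> exists z, w = nu ++ z /\ w' = mu ++ z).
  { intros mu nu w w'; unfold act; simpl. destruct strip_prefix as [z|] eqn:E; [|easy].
    apply strip_prefix_spec in E. intros [= <-]. now exists z. }
  destruct s as [[mu nu]|], t as [[al be]|]; simpl; intro H.
  - pose proof (H nu) as H1. rewrite Hs in H1. symmetry in H1.
    pose proof (H be) as H2. rewrite Hs in H2.
    apply Hd in H1 as [z1 [E1 F1]]. apply Hd in H2 as [z2 [E2 F2]].
    assert (Hl := f_equal (@length bool) E1). rewrite E2, !length_app in Hl.
    destruct z1; simpl in Hl; [|lia]. destruct z2; simpl in Hl; [|lia].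
    rewrite app_nil_r in *. congruence.
  - specialize (H nu). now rewrite Hs in H.
  - specialize (H be). now rewrite Hs in H.
  - easy.
Qed.

(** Composition of partial maps is associative and the action is faithful, which avoids comparing
    normal forms. *)
Lemma cu_mul_assoc r s t :
  match cu_mul r s with Some x => cu_mul x t | None => None end =
  match cu_mul s t with Some x => cu_mul r x | None => None end.
Proof.
  apply act_faithful; intro w.
  transitivity (match act t w with
    | Some w' => match act s w' with Some w'' => act r w'' | None => None end
    | None => None end).
  - pose proof (act_mul r s) as H. destruct (cu_mul r s) as [x|]; simpl in H.
    + rewrite act_mul. destruct (act t w); [apply H|easy].
    + destruct (act t w) as [w'|]; [apply H|easy].
  - pose proof (act_mul s t w) as H. destruct (cu_mul s t) as [x|]; simpl in H.
    + rewrite act_mul, H. now destruct (act t w).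
    + simpl. destruct (act t w); [rewrite <- H|]; easy.
Qed.

Lemma cu_mul_e_l t : cu_mul cu_e t = Some t.
Proof. now destruct t. Qed.

Lemma conv_zero_l g : is_l1 g -> conv f_zero g = f_zero.
Proof. intros [N HN]. exact (bop_zero _ _ (bop_conv_l g N HN)). Qed.

Lemma conv_zero_r f : is_l1 f -> conv f f_zero = f_zero.
Proof. intros [N HN]. exact (bop_zero _ _ (bop_conv_r f N HN)). Qed.

Lemma conv_delta_opt_l (s : option Cu) t :
  conv (match s with Some r => delta r | None => f_zero end) (delta t) =
  match match s with Some r => cu_mul r t | None => None end with
  | Some r => delta r | None => f_zero end.
Proof.
  destruct s as [r|]; [apply conv_delta|]. apply conv_zero_l, is_l1_delta.
Qed.

Lemma conv_delta_opt_r t (s : option Cu) :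
  conv (delta t) (match s with Some r => delta r | None => f_zero end) =
  match match s with Some r => cu_mul t r | None => None end with
  | Some r => delta r | None => f_zero end.
Proof.
  destruct s as [r|]; [apply conv_delta|]. apply conv_zero_r, is_l1_delta.
Qed.

(** Both sides are bounded operators in each variable separately, so [bop_ext] replaces h, then g,
    then f by a delta, and associativity in the monoid remains. *)
Lemma conv_assoc f g h :
  is_l1 f -> is_l1 g -> is_l1 h -> conv (conv f g) h = conv f (conv g h).
Proof.
  intros Hf Hg Hh. revert h Hh.
  destruct Hf as [M HM], Hg as [N HN].
  refine (bop_ext _ _ _ _ (bop_conv_r _ _ (l1_le_conv f g M N HM HN))
    (bop_comp _ _ _ _ (bop_conv_r f M HM) (bop_conv_r g N HN)) _).
  intro t. pose proof (l1_le_delta t) as Ht. assert (Hg : is_l1 g) by now exists N.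
  clear HN. revert g Hg.
  refine (bop_ext _ _ _ _ (bop_comp _ _ _ _ (bop_conv_l _ _ Ht) (bop_conv_r f M HM))
    (bop_comp _ _ _ _ (bop_conv_r f M HM) (bop_conv_l _ _ Ht)) _).
  intro s. pose proof (l1_le_delta s) as Hs. assert (Hf : is_l1 f) by now exists M.
  clear HM. revert f Hf.
  refine (bop_ext _ _ _ _ (bop_comp _ _ _ _ (bop_conv_l _ _ Ht) (bop_conv_l _ _ Hs))
    (bop_conv_l _ _ (l1_le_conv _ _ _ _ Hs Ht)) _).
  intro r. rewrite !conv_delta, conv_delta_opt_l, conv_delta_opt_r.
  now rewrite cu_mul_assoc.
Qed.

Lemma bop_id : bounded_op (fun f => f) 1.
Proof. split; auto. intros f M HM; now rewrite Rmult_1_l. Qed.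

Lemma conv_unit_l f : is_l1 f -> conv unit_A f = f.
Proof.
  refine (bop_ext _ _ _ _ (bop_conv_r _ _ (l1_le_delta _)) bop_id _ f).
  intro s. unfold unit_A. now rewrite conv_delta, cu_mul_e_l.
Qed.

Lemma conv_unit_r f : is_l1 f -> conv f unit_A = f.
Proof.
  refine (bop_ext _ _ _ _ (bop_conv_l _ _ (l1_le_delta _)) bop_id _ f).
  intros [mu nu]. unfold unit_A. rewrite conv_delta. simpl.
  destruct nu; simpl; now rewrite ?app_nil_r.
Qed.

(** * Completeness and invertibility near the unit *)

(** Fatou's lemma for counting measure: on a finite list, pointwise convergence is uniform. *)
Lemma l1_le_limit {X : Type} (v : nat -> X -> C) (w : X -> C) M :
  (forall x eps, 0 < eps -> exists N, forall n, (N <= n)%nat -> Cmod (v n x - w x) < eps) ->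
  (exists N, forall n, (N <= n)%nat -> l1_le (v n) M) -> l1_le w M.
Proof.
  intros Hlim [N0 HM] l Hl. apply Rle_plus_epsilon; intros eps He.
  pose proof (pos_INR (length l)). set (e := eps / (INR (length l) + 1)).
  assert (He' : 0 < e) by (apply Rdiv_lt_0_compat; lra).
  assert (Hu : exists N, forall n, (N <= n)%nat -> forall x, In x l -> Cmod (v n x - w x) < e).
  { clear Hl H. clearbody e. induction l as [|x l [N1 IH]].
    - exists 0%nat; intros ? ? ? [].
    - destruct (Hlim x e He') as [N2 H2]. exists (N1 + N2)%nat.
      intros n Hn y [<-|Hy]; [apply H2; lia | apply IH; auto; lia]. }
  destruct Hu as [N1 H1]. set (n := (N0 + N1)%nat).
  apply Rle_trans with (finsumR (fun x => Cmod (v n x) + e) l).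
  - apply finsumR_le; intros x Hx.
    assert (Hd : Cmod (v n x - w x) < e) by (apply H1; auto; unfold n; lia).
    replace (w x) with (v n x + - (v n x - w x))%C by ring.
    eapply Rle_trans; [apply Cmod_triangle|]. rewrite Cmod_opp; lra.
  - rewrite finsumR_plus, finsumR_const. apply Rplus_le_compat.
    + apply HM; auto; unfold n; lia.
    + replace eps with (e * (INR (length l) + 1)) by (unfold e; field; lra).
      apply Rmult_le_compat_l; lra.
Qed.

Lemma C_cauchy_lim (z : nat -> C) :
  (forall eps, 0 < eps -> exists N, forall n, (N <= n)%nat -> Cmod (z n - z N) < eps) ->
  exists c, forall eps, 0 < eps -> exists N, forall n, (N <= n)%nat -> Cmod (z n - c) < eps.
Proof.
  intro H.
  assert (Hcv : forall p : C -> R, (forall a b, Rabs (p a - p b) <= Cmod (a - b)) ->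
            exists r, forall eps, 0 < eps -> exists N, forall n, (N <= n)%nat -> Rabs (p (z n) - r) < eps).
  { intros p Hp. destruct (Rcomplete.R_complete (fun n => p (z n))) as [r Hr].
    - intros eps He. destruct (H (eps / 2)) as [N HN]; [lra|]. exists N.
      intros n m Hn Hm. pose proof (HN n Hn); pose proof (HN m Hm).
      unfold Rdist. replace (p (z n) - p (z m)) with ((p (z n) - p (z N)) - (p (z m) - p (z N))) by ring.
      pose proof (Hp (z n) (z N)); pose proof (Hp (z m) (z N)).
      eapply Rle_lt_trans; [apply Rabs_triang|]. rewrite Rabs_Ropp; lra.
    - exists r; intros eps He. destruct (Hr eps He) as [N HN]. exists N; exact HN. }
  assert (Hp : forall a b : C, Rabs (fst a - fst b) <= Cmod (a - b) /\ Rabs (snd a - snd b) <= Cmod (a - b)).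
  { intros a b. pose proof (Rmax_Cmod (a - b)%C) as Hm. simpl in Hm.
    pose proof (Rmax_l (Rabs (fst a + - fst b)) (Rabs (snd a + - snd b))).
    pose proof (Rmax_r (Rabs (fst a + - fst b)) (Rabs (snd a + - snd b))).
    unfold Rminus; split; lra. }
  destruct (Hcv fst) as [x Hx]; [intros; apply Hp|].
  destruct (Hcv snd) as [y Hy]; [intros; apply Hp|].
  exists (x, y); intros eps He.
  destruct (Hx (eps / 2)) as [N1 H1]; [lra|]. destruct (Hy (eps / 2)) as [N2 H2]; [lra|].
  exists (N1 + N2)%nat; intros n Hn.
  specialize (H1 n ltac:(lia)); specialize (H2 n ltac:(lia)).
  replace (z n - (x, y))%C with (RtoC (fst (z n) - x) + Ci * RtoC (snd (z n) - y))%C.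
  - eapply Rle_lt_trans; [apply Cmod_triangle|]. rewrite Cmod_mult, !Cmod_R.
    replace (Cmod Ci) with 1; [lra|]. unfold Cmod, Ci; simpl.
    rewrite <- sqrt_1 at 1. f_equal; ring.
  - apply injective_projections; simpl; ring.
Qed.

Lemma l1_complete (u : nat -> Afun) (q : R) :
  0 <= q < 1 -> (forall n, l1_le (f_sub (u (S n)) (u n)) (q ^ n)) ->
  exists r, forall n, l1_le (f_sub r (u n)) (q ^ n / (1 - q)).
Proof.
  intros Hq Hu.
  assert (Hq0 : forall k, 0 <= q ^ k) by (intro; apply pow_le; lra).
  (* The bound is the closed form of q^n + ... + q^(n+k-1). *)
  assert (Hk : forall n k, l1_le (f_sub (u (n + k)%nat) (u n)) (q ^ n * (1 - q ^ k) / (1 - q))).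
  { intros n k; induction k as [|k IH].
    - rewrite Nat.add_0_r, f_sub_diag. eapply l1_le_weaken; [apply l1_le_zero|].
      right; simpl; field; lra.
    - eapply l1_le_weaken; [apply l1_le_sub_triangle with (u (n + k)%nat); [|exact IH]|].
      + rewrite Nat.add_succ_r. apply Hu.
      + right. rewrite pow_add; simpl; field; lra. }
  assert (Hk' : forall n m, (n <= m)%nat -> l1_le (f_sub (u m) (u n)) (q ^ n / (1 - q))).
  { intros n m Hnm. replace m with (n + (m - n))%nat by lia.
    eapply l1_le_weaken; [apply Hk|]. apply Rmult_le_compat_r.
    - left; apply Rinv_0_lt_compat; lra.
    - rewrite <- (Rmult_1_r (q ^ n)) at 2. apply Rmult_le_compat_l; auto.
      specialize (Hq0 (m - n)%nat); lra. }
  assert (Hc : forall t, exists c, forall eps, 0 < eps ->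
            exists N, forall n, (N <= n)%nat -> Cmod (u n t - c) < eps).
  { intro t. apply C_cauchy_lim. intros eps He.
    destruct (pow_lt_1_zero q) with (y := eps * (1 - q)) as [N HN].
    - rewrite Rabs_pos_eq; lra.
    - apply Rmult_lt_0_compat; lra.
    - exists N; intros n Hn. specialize (HN N (le_n N)).
      rewrite Rabs_pos_eq in HN by auto.
      eapply Rle_lt_trans; [apply (l1_le_pt _ _ t (Hk' N n Hn))|].
      apply Rmult_lt_reg_r with (1 - q); [lra|].
      replace (q ^ N / (1 - q) * (1 - q)) with (q ^ N) by (field; lra). lra. }
  destruct (choice (fun t c => forall eps, 0 < eps ->
            exists N, forall n, (N <= n)%nat -> Cmod (u n t - c) < eps) Hc) as [r Hr].
  exists r; intro n. apply l1_le_limit with (fun m => f_sub (u m) (u n)).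
  - intros t eps He. destruct (Hr t eps He) as [N HN]. exists N; intros m Hm.
    unfold f_sub. replace (_ - _)%C with (u m t - r t)%C by ring. auto.
  - exists n; intros m Hm; auto.
Qed.

Lemma l1_small_eq f g K q :
  0 <= q < 1 -> (forall n, l1_le (f_sub f g) (K * q ^ n)) -> f = g.
Proof.
  intros Hq H. assert (HK : 0 <= K) by (pose proof (l1_le_ge0 _ _ (H 0%nat)); simpl in *; lra).
  apply l1_le_0_eq; intros eps He.
  destruct (pow_lt_1_zero q) with (y := eps / (K + 1)) as [N HN].
  - rewrite Rabs_pos_eq; lra.
  - apply Rdiv_lt_0_compat; lra.
  - specialize (HN N (le_n N)). rewrite Rabs_pos_eq in HN by (apply pow_le; lra).
    eapply l1_le_weaken; [apply (H N)|].
    apply Rle_trans with ((K + 1) * (eps / (K + 1))).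
    + apply Rmult_le_compat; try lra. apply pow_le; lra.
    + right; field; lra.
Qed.

(** With h = 1 - d, the iterates of x |-> 1 + h x starting at 0 are the partial sums of the Neumann
    series. Their limit satisfies r = 1 + h r, that is, d r = 1. *)
Lemma neumann d q :
  is_l1 d -> 0 <= q < 1 -> l1_le (f_sub unit_A d) q ->
  exists r, is_l1 r /\ conv d r = unit_A.
Proof.
  intros Hd Hq Hh. set (h := f_sub unit_A d) in *.
  assert (H1 : is_l1 unit_A) by apply is_l1_delta.
  assert (Hl : is_l1 h) by now exists q.
  set (u := fix u n := match n with O => f_zero | S m => f_add unit_A (conv h (u m)) end).
  assert (Hul : forall n, is_l1 (u n)).
  { induction n as [|n IH]; simpl; [apply is_l1_zero|]. apply is_l1_add, is_l1_conv; auto. }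
  assert (Hstep : forall n, f_sub (u (S (S n))) (u (S n)) = conv h (f_sub (u (S n)) (u n))).
  { intro n. rewrite (bop_sub _ _ _ _ (bop_conv_r h q Hh)) by auto.
    extensionality t. simpl. unfold f_sub, f_add; ring. }
  assert (Hu : forall n, l1_le (f_sub (u (S n)) (u n)) (q ^ n)).
  { induction n as [|n IH].
    - simpl. eapply l1_le_dom; [|apply (l1_le_delta cu_e)]. intro t.
      rewrite conv_zero_r by easy. right; f_equal.
      unfold f_sub, f_add, f_zero, unit_A; ring.
    - rewrite Hstep. simpl. now apply l1_le_conv. }
  destruct (l1_complete u q Hq Hu) as [r Hr].
  (* As [u 0] is zero, the distance estimate at 0 bounds [r] itself. *)
  assert (Hrl : is_l1 r).
  { replace r with (f_sub r (u 0%nat)); [eexists; apply Hr|].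
    extensionality t; simpl; unfold f_sub, f_zero; ring. }
  exists r; split; [easy|].
  (* Both sides lie within a multiple of q^n of [u (S n)], for every n. *)
  assert (Hfix : r = f_add unit_A (conv h r)).
  { apply l1_small_eq with (2 / (1 - q)) q; [easy|]. intro n.
    assert (Hqn : 0 <= q ^ n) by (apply pow_le; lra).
    eapply l1_le_weaken; [apply l1_le_sub_triangle with (u (S n)); [apply Hr|]|].
    - simpl. eapply l1_le_dom; [|apply (l1_le_conv h (f_sub r (u n)) _ _ Hh (Hr n))].
      intro t. rewrite (bop_sub _ _ _ _ (bop_conv_r h q Hh)) by auto.
      right. rewrite <- Cmod_opp. f_equal. unfold f_sub, f_add; ring.
    - simpl. replace (2 / (1 - q) * q ^ n) with (q ^ n / (1 - q) + q ^ n / (1 - q)) by (field; lra).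
      replace (q * q ^ n / (1 - q)) with (q * (q ^ n / (1 - q))) by (field; lra).
      assert (0 <= q ^ n / (1 - q)) by (apply Rmult_le_pos; [auto | left; apply Rinv_0_lt_compat; lra]).
      assert (q * (q ^ n / (1 - q)) <= 1 * (q ^ n / (1 - q))) by (apply Rmult_le_compat_r; lra).
      lra. }
  assert (Hdh : d = f_sub unit_A h) by (extensionality t; unfold h, f_sub; ring).
  destruct Hrl as [Mr HMr].
  rewrite Hdh, (bop_sub _ _ _ _ (bop_conv_l r Mr HMr)), conv_unit_l by (auto; now exists Mr).
  rewrite Hfix at 1. extensionality t; unfold f_sub, f_add; ring.
Qed.

(** * The functionals [Phi q] *)

Definition ext (p : Cu) (w : Word) : Cu := (fst p ++ w, snd p ++ w).

Definition ones (n : nat) : Word := repeat false n.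

Lemma ext_app p w w' : ext (ext p w) w' = ext p (w ++ w').
Proof. unfold ext; simpl. now rewrite !app_assoc. Qed.

Lemma ext_nil p : ext p [] = p.
Proof. destruct p; unfold ext; simpl. now rewrite !app_nil_r. Qed.

Lemma ext_inj p p' w : ext p w = ext p' w -> p = p'.
Proof.
  destruct p, p'; unfold ext; simpl. intros [= H1 H2].
  apply app_inv_tail in H1, H2. congruence.
Qed.

(* With q = (mu, nu), these are the p = (sigma, tau) for which the groupoid element
   (mu 1^oo, |mu| - |nu|, nu 1^oo) lies in the bisection of s_sigma s_tau^star. *)
Definition hits (q p : Cu) : Prop := exists n g, ext q (ones n) = ext p g.

Definition phi (q p : Cu) : C :=
  if excluded_middle_informative (hits q p) then RtoC 1 else RtoC 0.

Definition Phi (q : Cu) (f : Afun) : C := Sum (fun p => phi q p * f p)%C.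

Lemma phi_le_1 q p : Cmod (phi q p) <= 1.
Proof. unfold phi; destruct excluded_middle_informative; rewrite ?Cmod_0, ?Cmod_1; lra. Qed.

Lemma l1_le_phi q f M : l1_le f M -> l1_le (fun p => phi q p * f p)%C M.
Proof.
  apply l1_le_dom; intro p. rewrite Cmod_mult. pose proof (phi_le_1 q p).
  pose proof (Cmod_ge_0 (f p)). rewrite <- (Rmult_1_l (Cmod (f p))) at 2.
  now apply Rmult_le_compat_r.
Qed.

Lemma Phi_spec q f : is_l1 f -> has_sum (fun p => phi q p * f p)%C (Phi q f).
Proof. intros [M HM]. apply Sum_spec with M. now apply l1_le_phi. Qed.

Lemma Phi_add q f g : is_l1 f -> is_l1 g -> Phi q (f_add f g) = (Phi q f + Phi q g)%C.
Proof.
  intros Hf Hg. apply Sum_eq.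
  refine (has_sum_ext _ _ _ _ (has_sum_plus _ _ _ _ (Phi_spec q f Hf) (Phi_spec q g Hg))).
  intro p; unfold f_add; ring.
Qed.

Lemma Phi_scale q a f : is_l1 f -> Phi q (f_scale a f) = (a * Phi q f)%C.
Proof.
  intros Hf. apply Sum_eq.
  refine (has_sum_ext _ _ _ _ (has_sum_scal a _ _ (Phi_spec q f Hf))).
  intro p; unfold f_scale; ring.
Qed.

Lemma Phi_sub q f g : is_l1 f -> is_l1 g -> Phi q (f_sub f g) = (Phi q f - Phi q g)%C.
Proof.
  intros Hf Hg. rewrite f_sub_add, Phi_add, Phi_scale by (auto; now apply is_l1_scale). ring.
Qed.

Lemma Phi_zero q : Phi q f_zero = 0%C.
Proof. rewrite <- (f_sub_diag f_zero), Phi_sub by apply is_l1_zero. ring. Qed.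

Lemma Phi_le q f M : l1_le f M -> Cmod (Phi q f) <= M.
Proof.
  intro HM. apply has_sum_bound with (fun p => phi q p * f p)%C; [|now apply l1_le_phi].
  apply Phi_spec. now exists M.
Qed.

Lemma Phi_delta q p : Phi q (delta p) = phi q p.
Proof.
  apply Sum_eq. replace (phi q p) with (phi q p * delta p p)%C.
  - apply (has_sum_single (fun x => phi q x * delta p x)%C).
    intros y Hy; unfold delta; destruct Cu_eq_dec; [congruence | ring].
  - unfold delta; destruct Cu_eq_dec; [ring | congruence].
Qed.

(** Recasts the functional as an operator on A, so that [bop_ext] and [bop_eq_closed] apply to
    it. *)
Definition Phi_op (q : Cu) (f : Afun) : Afun := f_scale (Phi q f) unit_A.

Lemma bop_Phi q : bounded_op (Phi_op q) 1.
Proof.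
  split.
  - intros f g Hf Hg; unfold Phi_op. rewrite Phi_add by auto.
    extensionality t; unfold f_scale, f_add; ring.
  - intros a f Hf; unfold Phi_op. rewrite Phi_scale by auto.
    extensionality t; unfold f_scale; ring.
  - intros f M HM. eapply l1_le_weaken; [apply l1_le_scal, l1_le_delta|].
    pose proof (Phi_le q f M HM); lra.
Qed.

Lemma Phi_op_0 q f : Phi_op q f = f_zero -> Phi q f = 0%C.
Proof.
  intro H. pose proof (equal_f H cu_e) as H1.
  unfold Phi_op, f_scale, unit_A, delta, f_zero in H1.
  destruct Cu_eq_dec; [|congruence]. rewrite <- H1; ring.
Qed.

Lemma hits_ext q p w : hits q (ext p w) -> hits q p.
Proof. intros [n [g H]]. exists n, (w ++ g). now rewrite H, ext_app. Qed.

(** Lengthening the run of 1s by one letter makes the remainder after p nonempty; its first letter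
    selects the child. *)
Lemma hits_extend q p : hits q p -> hits q (ext p [false]) \/ hits q (ext p [true]).
Proof.
  intros [n [g H]].
  assert (H' : ext q (ones (S n)) = ext p (g ++ [false])).
  { unfold ones. replace (S n) with (n + 1)%nat by lia.
    rewrite repeat_app, <- !ext_app. now f_equal. }
  destruct g as [|b g]; simpl in H'.
  - left. exists (S n), []. now rewrite ext_nil.
  - destruct b; [right | left]; exists (S n), (g ++ [false]); now rewrite ext_app.
Qed.

(** Lengthening the shorter run to the longer one yields two factorisations of the same pair through
    p, whose next letters must agree. *)
Lemma hits_disjoint q p : hits q (ext p [false]) -> hits q (ext p [true]) -> False.
Proof.
  assert (H : forall n m g h b c, (n <= m)%nat -> b <> c ->
            ext q (ones n) = ext (ext p [b]) g -> ext q (ones m) = ext (ext p [c]) h -> False).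
  { intros n m g h b c Hnm Hbc E1 E2. replace m with (n + (m - n))%nat in E2 by lia.
    unfold ones in E2. rewrite repeat_app, <- ext_app in E2. fold (ones n) in E2.
    rewrite E1, !ext_app in E2. injection E2 as E2 _. apply app_inv_head in E2.
    simpl in E2. congruence. }
  intros [n [g E1]] [m [h E2]]. destruct (Nat.le_ge_cases n m).
  - now apply (H n m g h false true).
  - now apply (H m n h g true false).
Qed.

Lemma phi_split q p : phi q p = (phi q (ext p [false]) + phi q (ext p [true]))%C.
Proof.
  pose proof (hits_ext q p [false]) as H1. pose proof (hits_ext q p [true]) as H2.
  pose proof (hits_extend q p) as H3. pose proof (hits_disjoint q p) as H4.
  unfold phi; repeat destruct excluded_middle_informative; try ring; exfalso; tauto.
Qed.

(** * The ideal J *)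

(** For p = (mu, nu), the translate of [f0] by s_mu on the left and s_nu^star on the right. *)
Definition block (p : Cu) : Afun :=
  f_sub (f_sub (delta p) (delta (ext p [false]))) (delta (ext p [true])).

Lemma is_l1_block p : is_l1 (block p).
Proof. apply is_l1_sub; [apply is_l1_sub|]; apply is_l1_delta. Qed.

Lemma Phi_block q p : Phi q (block p) = 0%C.
Proof.
  unfold block.
  rewrite !Phi_sub, !Phi_delta, (phi_split q p) by (try apply is_l1_sub; apply is_l1_delta).
  ring.
Qed.

(** Both s_1^star and s_2^star annihilate [f0] from the left, so only a left factor s_mu without
    starred letters survives. *)
Lemma conv_delta_f0 s :
  conv (delta s) f0 = match snd s with
    | [] => f_sub (f_sub (delta s) (delta (fst s ++ [false], [false])))
                  (delta (fst s ++ [true], [true]))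
    | _ => f_zero end.
Proof.
  unfold f0. pose proof (bop_conv_r _ _ (l1_le_delta s)) as Hs.
  rewrite !(bop_sub _ _ _ _ Hs) by (try apply is_l1_sub; apply is_l1_delta).
  rewrite !conv_delta. destruct s as [mu [|b nu]].
  - simpl. now rewrite app_nil_r.
  - simpl. destruct b; simpl; destruct nu; simpl; rewrite ?app_nil_r;
      extensionality t; unfold f_sub, f_zero, Word; ring.
Qed.

(** Dually, s_1 and s_2 annihilate [f0] from the right. The nonzero two-sided translates of [f0] by
    monoid elements are therefore exactly the blocks. *)
Lemma conv_f0 s t :
  conv (conv (delta s) f0) (delta t) =
  match snd s, fst t with [], [] => block (fst s, snd t) | _, _ => f_zero end.
Proof.
  rewrite conv_delta_f0. pose proof (bop_conv_l _ _ (l1_le_delta t)) as Ht.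
  destruct s as [mu [|b nu]]; [|apply conv_zero_l, is_l1_delta]. simpl fst; simpl snd; cbv iota.
  rewrite !(bop_sub _ _ _ _ Ht) by (try apply is_l1_sub; apply is_l1_delta).
  rewrite !conv_delta. destruct t as [[|a al] be]; simpl.
  - now rewrite app_nil_r.
  - destruct a; simpl; destruct al; simpl; rewrite ?app_nil_r, <- ?app_assoc; simpl;
      extensionality t; unfold f_sub, f_zero, Word; ring.
Qed.

Lemma bop_null : bounded_op (fun _ => f_zero) 0.
Proof.
  split.
  - intros; extensionality t; unfold f_add, f_zero; ring.
  - intros; extensionality t; unfold f_scale, f_zero; ring.
  - intros f M _. rewrite Rmult_0_l. apply l1_le_zero.
Qed.

Lemma is_l1_f0 : is_l1 f0.
Proof. exact (is_l1_block cu_e). Qed.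

Lemma Phi_conv_f0 q b c : is_l1 b -> is_l1 c -> Phi q (conv (conv b f0) c) = 0%C.
Proof.
  intros Hb Hc. apply Phi_op_0. destruct is_l1_f0 as [M0 HM0]. revert b Hb.
  destruct Hc as [Mc HMc].
  refine (bop_ext _ _ _ _ (bop_comp _ _ _ _ (bop_Phi q)
    (bop_comp _ _ _ _ (bop_conv_l c Mc HMc) (bop_conv_l f0 M0 HM0))) bop_null _).
  intro s. assert (Hc : is_l1 c) by now exists Mc. clear HMc. revert c Hc.
  refine (bop_ext _ _ _ _ (bop_comp _ _ _ _ (bop_Phi q)
    (bop_conv_r _ _ (l1_le_conv _ _ _ _ (l1_le_delta s) HM0))) bop_null _).
  intro t. rewrite conv_f0. unfold Phi_op.
  replace (Phi q _) with (RtoC 0); [extensionality x; unfold f_scale, f_zero; ring|].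
  destruct (snd s), (fst t); rewrite ?Phi_block, ?Phi_zero; easy.
Qed.

(** Quantifying over all two-sided multiples reduces the ideal property to associativity; closedness
    comes from the continuity of each [Phi q]. As this ideal contains [f0], it contains [J]. *)
Definition Phi_null (f : Afun) : Prop :=
  is_l1 f /\ forall b c q, is_l1 b -> is_l1 c -> Phi q (conv (conv b f) c) = 0%C.

Lemma bop_sandwich b c M N :
  l1_le b M -> l1_le c N -> bounded_op (fun f => conv (conv b f) c) (N * M).
Proof. intros Hb Hc. exact (bop_comp _ _ _ _ (bop_conv_l c N Hc) (bop_conv_r b M Hb)). Qed.

Lemma closed_ideal_Phi_null : closed_ideal Phi_null.
Proof.
  repeat split.
  - now intros f [Hf _].
  - apply is_l1_zero.
  - intros b c q [M HM] [N HN].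
    rewrite (bop_zero _ _ (bop_sandwich b c M N HM HN)). apply Phi_zero.
  - apply is_l1_add; [apply H | apply H0].
  - intros b c q Hb Hc. destruct H as [Hf H], H0 as [Hg H0].
    pose proof Hb as [M HM]; pose proof Hc as [N HN].
    rewrite (bop_add _ _ (bop_sandwich b c M N HM HN)) by auto.
    rewrite Phi_add by (repeat apply is_l1_conv; auto). rewrite H, H0 by auto. ring.
  - apply is_l1_scale, H.
  - intros b c q Hb Hc. destruct H as [Hf H].
    pose proof Hb as [M HM]; pose proof Hc as [N HN].
    rewrite (bop_scale _ _ (bop_sandwich b c M N HM HN)) by auto.
    rewrite Phi_scale by (repeat apply is_l1_conv; auto). rewrite H by auto. ring.
  - apply is_l1_conv; [auto | apply H].
  - intros b c q Hb Hc. destruct H as [Hf H].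
    rewrite <- (conv_assoc b g f) by auto. apply H; auto. now apply is_l1_conv.
  - apply is_l1_conv; [apply H | auto].
  - intros b c q Hb Hc. destruct H as [Hf H].
    rewrite <- (conv_assoc b f g), conv_assoc by (auto; now apply is_l1_conv).
    apply H; auto. now apply is_l1_conv.
  - easy.
  - intros b c q [M HM] [N HN]. apply Phi_op_0.
    refine (bop_eq_closed _ _ _ _ f (bop_comp _ _ _ _ (bop_Phi q) (bop_sandwich b c M N HM HN))
      bop_null H _).
    intros eps He. destruct (H0 eps He) as [g [[Hg Hg0] [r [Hr Hd]]]].
    exists g; split; [easy|]; split.
    + unfold Phi_op. rewrite Hg0 by (now eexists; eauto).
      extensionality x; unfold f_scale, f_zero; ring.
    + apply l1_le_weaken with r; [exact Hd | lra].
Qed.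

Lemma J_Phi_null f : J f -> Phi_null f.
Proof.
  intro H. apply (H Phi_null closed_ideal_Phi_null). split; [apply is_l1_f0|].
  intros; now apply Phi_conv_f0.
Qed.

Lemma J_l1 f : J f -> is_l1 f.
Proof. intro H; apply (J_Phi_null f H). Qed.

Lemma J_Phi f q : J f -> Phi q f = 0%C.
Proof.
  intro H. destruct (J_Phi_null f H) as [Hf H0].
  rewrite <- (conv_unit_l f), <- (conv_unit_r (conv unit_A f)); auto.
  - apply H0; apply is_l1_delta.
  - apply is_l1_conv; [apply is_l1_delta | auto].
Qed.

Lemma J_zero : J f_zero.
Proof. intros K (K1 & K2 & _) _; exact K2. Qed.

Lemma J_add f g : J f -> J g -> J (f_add f g).
Proof. intros Hf Hg K HK H0. pose proof HK as (K1 & K2 & K3 & _). exact (K3 _ _ (Hf K HK H0) (Hg K HK H0)). Qed.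

Lemma J_scale a f : J f -> J (f_scale a f).
Proof. intros Hf K HK H0. pose proof HK as (K1 & K2 & K3 & K4 & _). exact (K4 _ _ (Hf K HK H0)). Qed.

Lemma J_conv_l f g : is_l1 g -> J f -> J (conv g f).
Proof.
  intros Hg Hf K HK H0. pose proof HK as (K1 & K2 & K3 & K4 & K5 & _). exact (proj1 (K5 _ _ (Hf K HK H0) Hg)).
Qed.

Lemma J_conv_r f g : is_l1 g -> J f -> J (conv f g).
Proof.
  intros Hg Hf K HK H0. pose proof HK as (K1 & K2 & K3 & K4 & K5 & _). exact (proj2 (K5 _ _ (Hf K HK H0) Hg)).
Qed.

Lemma J_closed f :
  is_l1 f -> (forall eps, 0 < eps -> exists g, J g /\ l1_dist_lt f g eps) -> J f.
Proof.
  intros Hf H K HK H0. pose proof HK as (K1 & K2 & K3 & K4 & K5 & K6).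
  apply K6; auto. intros eps He. destruct (H eps He) as [g [Hg Hd]]. exists g; split; [exact (Hg K HK H0) | easy].
Qed.

Lemma J_block p : J (block p).
Proof.
  replace (block p) with (conv (conv (delta (fst p, [])) f0) (delta ([], snd p))).
  - apply J_conv_r; [apply is_l1_delta|]. apply J_conv_l; [apply is_l1_delta|]. intros I _ H; exact H.
  - rewrite conv_f0. now destruct p.
Qed.

(** * Compressing to a scalar *)

Lemma app_inj_tail_length {X : Type} (a b c d : list X) :
  a ++ b = c ++ d -> length b = length d -> a = c /\ b = d.
Proof.
  revert c; induction a as [|x a IH]; intros [|y c] H Hl; simpl in *; auto.
  - subst b. simpl in Hl. rewrite length_app in Hl. lia.
  - subst d. simpl in Hl. rewrite length_app in Hl. lia.
  - injection H as -> H. destruct (IH c H Hl). now subst.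
Qed.

Definition tip (w : Word) (n : nat) : Word := (w ++ ones n) ++ [true].

(* The remainder g would put a 2 inside the run 1^n of nu 1^n 2. *)
Lemma tip_overlap mu nu sg ta ga g n :
  (length sg + length nu <= n)%nat ->
  tip mu n = sg ++ ga -> tip nu n = (ta ++ ga) ++ g -> g = [].
Proof.
  intros Hn H1 H2. unfold tip in *.
  assert (Hl := f_equal (@length bool) H1). rewrite !length_app in Hl.
  unfold ones in Hl at 1. rewrite repeat_length in Hl. simpl in Hl.
  (* The word sg is shorter than mu 1^n 2, so ga is nonempty and ends with the final 2. *)
  destruct ga as [|x ga' _] using rev_ind; [simpl in Hl; lia|].
  rewrite app_assoc in H1. apply app_inj_tail in H1 as [_ <-].
  destruct g as [|y g' _] using rev_ind; [easy|]. exfalso.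
  rewrite app_assoc in H2. apply app_inj_tail in H2 as [H2 _].
  rewrite length_app in Hl; simpl in Hl.
  (* This is the position of the 2 that ends ga. The bound on n places it past nu, hence among the
     1s. *)
  assert (Hk := f_equal (fun l => nth_error l (length ta + length ga')) H2). cbv beta in Hk.
  rewrite nth_error_app2 in Hk by lia.
  rewrite <- !app_assoc, (app_assoc ta), nth_error_app2 in Hk by (rewrite length_app; lia).
  rewrite length_app, Nat.sub_diag in Hk. simpl in Hk.
  apply nth_error_In, repeat_spec in Hk. discriminate.
Qed.

(** For q = (mu, nu), the compression s_{mu 1^n 2}^star a s_{nu 1^n 2}. *)
Definition corner (q : Cu) (n : nat) (a : Afun) : Afun :=
  conv (conv (delta ([], tip (fst q) n)) a) (delta (tip (snd q) n, [])).

Lemma bop_corner q n : bounded_op (corner q n) 1.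
Proof.
  replace 1 with (1 * 1) by ring. unfold corner.
  apply bop_sandwich; apply l1_le_delta.
Qed.

(** The length bound makes g nonempty, so the final 2 can be removed from both factorisations,
    leaving a witness with run length n. *)
Lemma hits_tip q p n g :
  tip (fst q) n = fst p ++ g -> tip (snd q) n = snd p ++ g -> (length (fst p) <= n)%nat ->
  hits q p.
Proof.
  intros H1 H2 Hn. unfold tip in *.
  destruct g as [|x g _] using rev_ind.
  - apply (f_equal (@length bool)) in H1. rewrite !length_app in H1.
    unfold ones in H1. rewrite repeat_length in H1. simpl in H1. lia.
  - rewrite app_assoc in H1, H2.
    apply app_inj_tail in H1 as [H1 _]. apply app_inj_tail in H2 as [H2 _].
    exists n, g. unfold ext. now rewrite H1, H2.
Qed.

Lemma tip_hits q p m g n :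
  ext q (ones m) = ext p g -> (m <= n)%nat ->
  exists g', tip (fst q) n = fst p ++ g' /\ tip (snd q) n = snd p ++ g'.
Proof.
  intros H Hn. exists (g ++ ones (n - m) ++ [true]).
  injection H as H1 H2. unfold tip.
  replace n with (m + (n - m))%nat at 1 3 by lia.
  unfold ones in *. rewrite repeat_app. rewrite !app_assoc, H1, H2. now rewrite <- !app_assoc.
Qed.

(** For p = (sg, ta), the left product is nonzero only if mu 1^n 2 = sg g, and is then the star of
    s_{ta g}. Multiplying by s_{nu 1^n 2} gives e if nu 1^n 2 = ta g, and 0 otherwise, since
    [tip_overlap] excludes proper overlaps. For large n the first outcome means exactly that q hits
    p. *)
Lemma corner_delta q p :
  exists N, forall n, (N <= n)%nat -> corner q n (delta p) = Phi_op q (delta p).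
Proof.
  (* Fixes in advance a run length witnessing the hit, so that N can be chosen before the case
     distinction; without a hit any value serves. *)
  assert (HN : exists m0, hits q p -> exists m g, (m <= m0)%nat /\ ext q (ones m) = ext p g).
  { destruct (classic (hits q p)) as [[m [g H]]|H]; [|now exists 0%nat].
    exists m; intros _. now exists m, g. }
  destruct HN as [m0 Hm0]. destruct p as [sg ta], q as [mu nu].
  (* Large enough for the witnessing run to fit, for the tips to be longer than sg and ta, and for
     [tip_overlap] to apply with mu and nu in either order. *)
  exists (m0 + length sg + length ta + length mu + length nu)%nat. intros n Hn.
  unfold corner, Phi_op. rewrite Phi_delta, conv_delta, conv_delta_opt_l. simpl fst; simpl snd.
  assert (Hone : forall g, tip mu n = sg ++ g -> tip nu n = ta ++ g -> hits (mu, nu) (sg, ta)).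
  { intros g H1 H2. apply (hits_tip (mu, nu) (sg, ta) n g); auto; simpl; lia. }
  assert (Htip : hits (mu, nu) (sg, ta) -> exists g, tip mu n = sg ++ g /\ tip nu n = ta ++ g).
  { intro H. destruct (Hm0 H) as [m [g [Hm E]]].
    apply (tip_hits (mu, nu) (sg, ta) m g n E). lia. }
  assert (Hlen : forall w, length (tip w n) = (length w + n + 1)%nat).
  { intro w; unfold tip, ones. now rewrite !length_app, repeat_length. }
  unfold cu_mul at 1.
  destruct (strip_prefix (tip mu n) sg) as [g|] eqn:E1.
  { apply strip_prefix_spec in E1. apply (f_equal (@length bool)) in E1.
    rewrite length_app, Hlen in E1. lia. }
  assert (Hno : ~ hits (mu, nu) (sg, ta) -> f_zero = f_scale (phi (mu, nu) (sg, ta)) unit_A).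
  { intro H. extensionality t. unfold phi; destruct excluded_middle_informative; [easy|].
    unfold f_zero, f_scale; ring. }
  destruct (strip_prefix sg (tip mu n)) as [g|] eqn:E2.
  2:{ apply Hno. intro H. destruct (Htip H) as [g [Hg _]].
      rewrite Hg, strip_prefix_app in E2. discriminate. }
  apply strip_prefix_spec in E2. unfold cu_mul.
  assert (Hyes : tip nu n = ta ++ g -> delta ([], []) = f_scale (phi (mu, nu) (sg, ta)) unit_A).
  { intro H. extensionality t. unfold phi; destruct excluded_middle_informative as [?|Hn'].
    - unfold f_scale, unit_A, cu_e; ring.
    - exfalso; eauto. }
  destruct (strip_prefix (ta ++ g) (tip nu n)) as [g'|] eqn:E3.
  - apply strip_prefix_spec in E3.
    assert (g' = []) by (apply (tip_overlap mu nu sg ta g g' n); auto; lia). subst g'.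
    apply Hyes. now rewrite app_nil_r in E3.
  - destruct (strip_prefix (tip nu n) (ta ++ g)) as [g'|] eqn:E4.
    + exfalso. apply strip_prefix_spec in E4.
      (* Both ta and the longer tip are prefixes of the word ta g, so ta is a prefix of the tip. *)
      assert (Hs : strip_prefix ta (tip nu n) <> None).
      { intro Hs. pose proof (strip_prefix_long ta (tip nu n) g') as Hx.
        rewrite <- E4, strip_prefix_app, Hs in Hx.
        destruct (strip_prefix (tip nu n) ta) as [h|] eqn:Eh; [|discriminate].
        apply strip_prefix_spec in Eh. apply (f_equal (@length bool)) in Eh.
        rewrite length_app, Hlen in Eh. lia. }
      destruct (strip_prefix ta (tip nu n)) as [h|] eqn:Eh; [|easy].
      apply strip_prefix_spec in Eh. rewrite Eh, <- app_assoc in E4.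
      apply app_inv_head in E4. subst g.
      (* The overhang now lies on the other side: nu 1^n 2 = ta h and mu 1^n 2 = sg h g', so mu and
         nu exchange roles. *)
      assert (g' = []).
      { apply (tip_overlap nu mu ta sg h g' n); auto; [lia|]. now rewrite <- app_assoc. }
      subst g'. rewrite app_nil_r in E3. rewrite Eh in E3 at 1.
      rewrite <- (app_nil_r (ta ++ h)) in E3 at 2. rewrite strip_prefix_app in E3. discriminate.
    + apply Hno. intro H. destruct (Htip H) as [h [H1 H2]].
      rewrite H1 in E2. apply app_inv_head in E2. subst h.
      rewrite H2 in E3. rewrite <- (app_nil_r (ta ++ g)) in E3 at 2.
      rewrite strip_prefix_app in E3. discriminate.
Qed.

(** The maps [corner q n] are bounded by 1 uniformly in n, so convergence on deltas spreads to all
    of A by an eps/3 argument. *)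
Lemma corner_limit q a :
  is_l1 a -> forall eps, 0 < eps ->
  exists N, forall n, (N <= n)%nat -> l1_le (f_sub (corner q n a) (Phi_op q a)) eps.
Proof.
  revert a. apply (l1_density (fun a => forall eps, 0 < eps ->
    exists N, forall n, (N <= n)%nat -> l1_le (f_sub (corner q n a) (Phi_op q a)) eps)).
  - intros p eps He. destruct (corner_delta q p) as [N HN]. exists N; intros n Hn.
    rewrite HN, f_sub_diag by easy. eapply l1_le_weaken; [apply l1_le_zero | lra].
  - intros f g Hf Hg Pf Pg eps He.
    destruct (Pf (eps / 2)) as [N1 H1]; [lra|]. destruct (Pg (eps / 2)) as [N2 H2]; [lra|].
    exists (N1 + N2)%nat; intros n Hn.
    rewrite (bop_add _ _ (bop_corner q n)), (bop_add _ _ (bop_Phi q)) by auto.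
    replace eps with (eps / 2 + eps / 2) by field.
    eapply l1_le_dom; [|apply l1_le_plus; [apply (H1 n) | apply (H2 n)]; lia].
    intro t; right; f_equal; unfold f_sub, f_add; ring.
  - intros a f Hf Pf eps He. pose proof (Cmod_ge_0 a).
    destruct (Pf (eps / (Cmod a + 1))) as [N HN]; [apply Rdiv_lt_0_compat; lra|].
    exists N; intros n Hn.
    rewrite (bop_scale _ _ (bop_corner q n)), (bop_scale _ _ (bop_Phi q)) by auto.
    eapply l1_le_weaken; [eapply l1_le_dom; [|apply (l1_le_scal a _ _ (HN n Hn))]|].
    + intro t; right; f_equal; unfold f_sub, f_scale; ring.
    + apply Rle_trans with ((Cmod a + 1) * (eps / (Cmod a + 1))); [|right; field; lra].
      apply Rmult_le_compat_r; [left; apply Rdiv_lt_0_compat|]; lra.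
  - intros f Hf H eps He. destruct (H (eps / 3)) as [g [Hg [Pg Hfg]]]; [lra|].
    destruct (Pg (eps / 3)) as [N HN]; [lra|]. exists N; intros n Hn.
    apply l1_le_weaken with (1 * (eps / 3) + (eps / 3 + 1 * (eps / 3))); [|right; field].
    apply l1_le_sub_triangle with (corner q n g).
    + rewrite <- (bop_sub _ _ _ _ (bop_corner q n)) by auto. now apply (bop_le _ _ (bop_corner q n)).
    + apply l1_le_sub_triangle with (Phi_op q g); [auto|].
      rewrite <- (bop_sub _ _ _ _ (bop_Phi q)) by auto.
      apply (bop_le _ _ (bop_Phi q)). now apply l1_le_sub_sym.
Qed.

Lemma factor_unit q a :
  is_l1 a -> Phi q a <> 0%C ->
  exists b c, is_l1 b /\ is_l1 c /\ conv (conv b a) c = unit_A.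
Proof.
  intros Ha HP. set (z := Phi q a) in *.
  assert (Hz : 0 < Cmod z) by now apply Cmod_gt_0.
  (* After division by z, the corner is within 1/2 of the unit. *)
  destruct (corner_limit q a Ha (Cmod z / 2)) as [n Hn]; [lra|].
  specialize (Hn n (le_n n)). set (e := corner q n a) in *.
  assert (He : is_l1 e) by (apply (bop_l1 _ _ _ (bop_corner q n)); auto).
  destruct (neumann (f_scale (/ z)%C e) (1 / 2)) as [r [Hr Er]].
  - now apply is_l1_scale.
  - lra.
  - apply l1_le_sub_sym. apply (l1_le_scal (/ z)%C) in Hn.
    rewrite Cmod_inv in Hn by easy.
    replace (/ Cmod z * (Cmod z / 2)) with (1 / 2) in Hn by (field; lra).
    eapply l1_le_dom; [|exact Hn]. intro t; right; f_equal.
    unfold f_sub, Phi_op, f_scale. fold z. field. exact HP.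
  - exists (delta ([], tip (fst q) n)).
    exists (conv (delta (tip (snd q) n, [])) (f_scale (/ z)%C r)).
    assert (Hzr : is_l1 (f_scale (/ z)%C r)) by now apply is_l1_scale.
    split; [apply is_l1_delta|]. split; [apply is_l1_conv; auto; apply is_l1_delta|].
    rewrite <- conv_assoc by (auto; try apply is_l1_conv; auto; apply is_l1_delta).
    fold (corner q n a). fold e. rewrite <- Er.
    destruct He as [M HM], Hr as [M' HM'].
    rewrite (bop_scale _ _ (bop_conv_r e M HM)) by now exists M'.
    now rewrite (bop_scale _ _ (bop_conv_l r M' HM')) by now exists M.
Qed.

(** * Elements annihilated by every [Phi q] *)

(** The maximum makes every level finite, while appending a common letter to both words still raises
    the level by exactly one. *)
Definition lev (p : Cu) : nat := Nat.max (length (fst p)) (length (snd p)).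

Lemma lev_ext p w : lev (ext p w) = (lev p + length w)%nat.
Proof. unfold lev, ext; simpl. rewrite !length_app. lia. Qed.

(** Comparing levels gives n = (lev p - lev q) + |g|, so g cancels against the last |g| letters of
    the run and p = q 1^j is left. *)
Lemma hits_lev q p :
  hits q p -> (lev q <= lev p)%nat -> ext q (ones (lev p - lev q)) = p.
Proof.
  intros [n [g H]] Hl. assert (Hn := f_equal lev H). rewrite !lev_ext in Hn.
  unfold ones in Hn. rewrite repeat_length in Hn.
  replace n with ((lev p - lev q) + length g)%nat in H by lia.
  unfold ones in H. rewrite repeat_app, <- ext_app in H. fold (ones (lev p - lev q)) in H.
  set (p' := ext q (ones (lev p - lev q))) in *. destruct p as [a b], p' as [c d].
  unfold ext in H; simpl in H. injection H as H1 H2.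
  apply app_inj_tail_length in H1 as [H1 _]; [|apply repeat_length].
  apply app_inj_tail_length in H2 as [H2 _]; [|apply repeat_length]. congruence.
Qed.

Lemma words_le n : exists l : list Word, forall w, (length w <= n)%nat -> In w l.
Proof.
  induction n as [|n [l Hl]].
  - exists [[]]. intros [|b w]; simpl; [auto | lia].
  - exists ([] :: map (cons false) l ++ map (cons true) l).
    intros [|b w] Hw; [now left|right]. apply in_app_iff. simpl in Hw.
    destruct b; [right | left]; apply in_map, Hl; lia.
Qed.

Lemma level_list n : exists l, NoDup l /\ forall t, In t l <-> lev t = n.
Proof.
  destruct (words_le n) as [l Hl].
  exists (nodup Cu_eq_dec (filter (fun t => Nat.eqb (lev t) n) (list_prod l l))).
  split; [apply NoDup_nodup|]. intro t. rewrite nodup_In, filter_In, Nat.eqb_eq.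
  split; [tauto|]. intro Ht; split; [|easy]. destruct t as [a b]; unfold lev in Ht; simpl in Ht.
  apply in_prod; apply Hl; lia.
Qed.

Fixpoint block_comb (l : list Cu) (f : Afun) : Afun :=
  match l with
  | [] => f_zero
  | x :: l' => f_add (f_scale (f x) (block x)) (block_comb l' f)
  end.

Lemma J_block_comb l f : J (block_comb l f).
Proof.
  induction l as [|x l IH]; [apply J_zero|]. apply J_add; [|easy]. apply J_scale, J_block.
Qed.

Lemma block_comb_low l f n t :
  (forall p, In p l -> lev p = n) -> (lev t <= n)%nat -> block_comb l f t = comb l f t.
Proof.
  intros Hl Ht. induction l as [|p l IH]; [easy|]. simpl.
  assert (Hp : lev p = n) by (apply Hl; now left).
  unfold f_add at 1 2. rewrite IH by (intros; apply Hl; now right). f_equal.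
  unfold f_scale, block, f_sub. f_equal.
  assert (Hd : forall b, delta (ext p [b]) t = 0%C).
  { intro b; unfold delta. destruct Cu_eq_dec as [<-|]; [|easy].
    rewrite lev_ext in Ht; simpl in Ht; lia. }
  rewrite !Hd. ring.
Qed.

Lemma block_comb_high l f n t :
  (forall p, In p l -> lev p = n) -> (S n < lev t)%nat -> block_comb l f t = 0%C.
Proof.
  intros Hl Ht. induction l as [|p l IH]; [easy|]. simpl.
  assert (Hp : lev p = n) by (apply Hl; now left).
  unfold f_add. rewrite IH by (intros; apply Hl; now right).
  unfold f_scale, block, f_sub, delta.
  destruct (Cu_eq_dec p t) as [<-|]; [lia|].
  destruct (Cu_eq_dec (ext p [false]) t) as [<-|]; [rewrite lev_ext in Ht; simpl in Ht; lia|].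
  destruct (Cu_eq_dec (ext p [true]) t) as [<-|]; [rewrite lev_ext in Ht; simpl in Ht; lia|].
  ring.
Qed.

(* Modulo J, the mass of a below level n is pushed down to level n. *)
Lemma push_to_level a n :
  exists g, J g /\ (forall t, (lev t < n)%nat -> g t = a t) /\
    (forall t, (n < lev t)%nat -> g t = 0%C).
Proof.
  induction n as [|n [g [Jg [H1 H2]]]].
  - exists f_zero; split; [apply J_zero|]. split; [intros; lia | easy].
  - destruct (level_list n) as [l [Hn Hl]].
    assert (Hl' : forall p, In p l -> lev p = n) by (intro; apply Hl).
    (* The blocks correct g to a on level n, leave lower levels unchanged, and otherwise affect
       level n + 1 only. *)
    exists (f_add g (block_comb l (f_sub a g))). split; [|split].
    + apply J_add; [easy | apply J_block_comb].
    + intros t Ht. unfold f_add. rewrite (block_comb_low l _ n t), comb_eval by (auto; lia).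
      destruct in_dec as [Hi|Hi].
      * unfold f_sub; ring.
      * rewrite H1; [ring|]. rewrite Hl in Hi. lia.
    + intros t Ht. unfold f_add. rewrite H2, (block_comb_high l _ n t) by (auto; lia). ring.
Qed.

Lemma lev_bound (l : list Cu) : exists n, forall t, In t l -> (lev t <= n)%nat.
Proof.
  induction l as [|x l [n IH]].
  - now exists 0%nat.
  - exists (lev x + n)%nat. intros t [<-|Ht]; [lia|]. specialize (IH t Ht); lia.
Qed.

(* If r vanishes below level n, then Phi q r = 0 at level n expresses r q through the
   entries r (q 1^j), j > 0, and those are distinct for distinct q. *)
Lemma level_l1_le r n M :
  is_l1 r -> (forall q, Phi q r = 0%C) -> (forall t, (lev t < n)%nat -> r t = 0%C) ->
  l1_le (fun t => if Nat.ltb n (lev t) then r t else RtoC 0) M -> l1_le r (M + M).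
Proof.
  intros Hr HPhi Hlow Hv. set (v := fun t => if Nat.ltb n (lev t) then r t else RtoC 0) in *.
  (* The vanishing of [Phi q r] will exhibit S, minus the level n part of r, as the matrix K applied
     to the part v beyond level n. *)
  set (S := fun q => if Nat.eqb (lev q) n then (- r q)%C else RtoC 0).
  set (K := fun q p => if Nat.eqb (lev q) n then if Nat.ltb n (lev p) then phi q p else RtoC 0
                       else RtoC 0).
  assert (HS : l1_le S M).
  { apply (kernel_l1_le K v); [easy| |].
    - intro p.
      destruct (classic (exists q, K q p <> 0%C)) as [[q Hq]|Hno].
      (* A nonzero entry in column p forces p = q 1^(lev p - n), which determines q. *)
      + assert (Hchar : forall q, K q p <> 0%C ->
                  (lev q <= lev p)%nat /\ lev q = n /\ ext q (ones (lev p - n)) = p).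
        { intros q' Hq'. unfold K in Hq'. destruct (Nat.eqb_spec (lev q') n) as [E|]; [|easy].
          destruct (Nat.ltb_spec n (lev p)) as [E'|]; [|easy].
          unfold phi in Hq'. destruct excluded_middle_informative as [Hh|]; [|easy].
          split; [lia|]. split; [easy|]. rewrite <- E. apply hits_lev; [easy | lia]. }
        apply l1_le_single with q.
        * intros q' Hne. apply NNPP; intro Hq'.
          destruct (Hchar q Hq) as [_ [_ E1]]. destruct (Hchar q' Hq') as [_ [_ E2]].
          apply Hne, (ext_inj _ _ (ones (lev p - n))). congruence.
        * unfold K. destruct Nat.eqb; [destruct Nat.ltb|]; rewrite ?Cmod_0; try lra.
          apply phi_le_1.
      + eapply l1_le_weaken; [eapply l1_le_dom; [|apply l1_le_zero] | apply Rle_0_1].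
        intro q. right; f_equal. apply NNPP; intro Hq; apply Hno; now exists q.
    - intro q. unfold K, S. destruct (Nat.eqb_spec (lev q) n) as [E|E].
      + pose proof (Phi_spec q r Hr) as H1. rewrite HPhi in H1.
        (* Adding this one-term family cancels the term at p = q in the sum for [Phi q r]; on level
           n no other p is hit by q. *)
        pose proof (has_sum_single (fun p => if Cu_eq_dec p q then (- r q)%C else RtoC 0) q) as H2.
        cbv beta in H2. destruct (Cu_eq_dec q q) as [_|]; [|easy].
        lapply H2; [clear H2; intro H2 | intros y Hy; destruct Cu_eq_dec; easy].
        pose proof (has_sum_plus _ _ _ _ H1 H2) as H3.
        replace (0 + - r q)%C with (- r q)%C in H3 by ring.
        refine (has_sum_ext _ _ _ _ H3). intro p; cbv beta. unfold v.
        destruct (Nat.ltb_spec n (lev p)) as [Hp|Hp].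
        * destruct (Cu_eq_dec p q) as [->|]; [lia | ring].
        * destruct (Cu_eq_dec p q) as [->|Hne].
          -- unfold phi. destruct excluded_middle_informative as [|Hno]; [ring|].
             exfalso; apply Hno. exists 0%nat, []. easy.
          -- destruct (Nat.eq_dec (lev p) n) as [Ep|Ep].
             ++ unfold phi. destruct excluded_middle_informative as [Hh|]; [|ring].
                exfalso; apply Hne. rewrite <- (hits_lev q p Hh) by lia.
                rewrite Ep, E, Nat.sub_diag. apply ext_nil.
             ++ rewrite Hlow by lia. ring.
      + refine (has_sum_ext _ _ _ _ (has_sum_single (fun _ => RtoC 0) cu_e _)); [|easy].
        intro p; ring. }
  eapply l1_le_dom; [|apply l1_le_plus; [exact Hv | apply HS]].
  intro t. unfold v, S. destruct (Nat.ltb_spec n (lev t)) as [H|H], (Nat.eqb_spec (lev t) n) as [H'|H'].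
  - lia.
  - right; f_equal; ring.
  - right. rewrite <- Cmod_opp. f_equal; ring.
  - rewrite Hlow by lia. right; f_equal; ring.
Qed.

Lemma J_of_Phi a : is_l1 a -> (forall q, Phi q a = 0%C) -> J a.
Proof.
  intros Ha HPhi. apply J_closed; [easy|]. intros eps He.
  destruct (l1_tail a (eps / 3) Ha) as [l [Hn Hl]]; [lra|].
  destruct (lev_bound l) as [n Hlev]. destruct (push_to_level a n) as [g [Jg [Hg1 Hg2]]].
  (* The remaining third of eps provides the strict inequality in [l1_dist_lt]. *)
  exists g; split; [easy|]. exists (eps / 3 + eps / 3); split; [lra|].
  assert (Hg : is_l1 g) by now apply J_l1.
  apply (level_l1_le (f_sub a g) n).
  - now apply is_l1_sub.
  - intro q. rewrite Phi_sub, HPhi, (J_Phi g q Jg) by auto. ring.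
  - intros t Ht. unfold f_sub. rewrite Hg1 by easy. ring.
  (* Beyond level n both g and the truncation of a to l vanish, so a - g agrees there with the tail
     of a. *)
  - eapply l1_le_dom; [|exact Hl]. intro t. destruct (Nat.ltb_spec n (lev t)) as [Ht|Ht].
    + right; f_equal. unfold f_sub. rewrite Hg2, comb_eval by easy.
      destruct in_dec as [Hi|]; [|easy]. specialize (Hlev t Hi); lia.
    + rewrite Cmod_0; apply Cmod_ge_0.
Qed.

(** * Infinite dimension, a non-invertible element, and the conclusion *)

Lemma hits_ones i j : hits (ones i, []) (ones j, []) <-> i = j.
Proof.
  split.
  - intros [n [g H]]. unfold ext in H; simpl in H. injection H as H1 H2. subst g.
    apply app_inv_tail in H1. apply (f_equal (@length bool)) in H1.
    unfold ones in H1. now rewrite !repeat_length in H1.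
  - intros ->. now exists 0%nat, [].
Qed.

(** The functionals at the powers of s_1 form a dual system to these powers. As they vanish on [J],
    the powers are linearly independent modulo [J]. *)
Lemma Phi_lincomb_ones i n c :
  let f := lincomb n c (fun j => delta (ones j, [])) in
  is_l1 f /\ Phi (ones i, []) f = if Nat.ltb i n then c i else RtoC 0.
Proof.
  induction n as [|n [H1 H2]]; simpl lincomb; cbv zeta.
  - split; [apply is_l1_zero | apply Phi_zero].
  - pose proof (is_l1_scale (c n) _ (is_l1_delta (ones n, []))) as Hn.
    split; [now apply is_l1_add|].
    rewrite Phi_add, Phi_scale, H2, Phi_delta by (auto; apply is_l1_delta).
    unfold phi. destruct excluded_middle_informative as [E|E]; rewrite hits_ones in E;
      destruct (Nat.ltb_spec i n), (Nat.ltb_spec i (S n)); try lia; subst; try ring.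
Qed.

Lemma not_J_unit : ~ J unit_A.
Proof.
  intro H. apply (J_Phi _ cu_e) in H. unfold unit_A in H. rewrite Phi_delta in H.
  unfold phi in H. destruct excluded_middle_informative as [_|Hn].
  - apply RtoC_inj in H. lra.
  - apply Hn. now exists 0%nat, [].
Qed.

(* Elements of A/J are classes [f] of f in A (is_l1 f); [f] = [g] iff J (f - g).
   1 = [delta_e], [f][g] = [f # g]. *)
Theorem theorem3p17 :
  (* A/J is infinite-dimensional (over C) *)
  (forall n : nat, exists F : nat -> Afun,
     (forall i, (i < n)%nat -> is_l1 (F i)) /\
     (forall c : nat -> C, J (lincomb n c F) -> forall i, (i < n)%nat -> c i = RtoC 0)) /\
  (* A/J is not a division algebra: some non-zero class has no inverse *)
  (exists a : Afun, is_l1 a /\ ~ J a /\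
     ~ (exists b : Afun, is_l1 b /\ J (f_sub (conv a b) unit_A) /\ J (f_sub (conv b a) unit_A))) /\
  (* purely infinite: every non-zero a has b, c with b a c = 1 *)
  (forall a : Afun, is_l1 a -> ~ J a ->
     exists b c : Afun, is_l1 b /\ is_l1 c /\ J (f_sub (conv (conv b a) c) unit_A)).
Proof.
  split; [|split].
  - intro n. exists (fun i => delta (ones i, [])). split; [intros; apply is_l1_delta|].
    intros c HJ i Hi. apply (J_Phi _ (ones i, [])) in HJ.
    rewrite (proj2 (Phi_lincomb_ones i n c)) in HJ.
    destruct (Nat.ltb_spec i n); [easy | lia].
  (* The witness is the isometry s_1, nonzero modulo [J] because s_1^star s_1 = e. *)
  - exists (delta ([false], [])). split; [apply is_l1_delta|]. split.
    + intro H. apply (J_conv_l _ (delta ([], [false]))) in H; [|apply is_l1_delta].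
      rewrite conv_delta in H. now apply not_J_unit in H.
    + intros [b [Hb [H _]]].
      (* Multiplying s_1 b - e by s_2^star on the left and s_2 on the right yields -e, since
         s_2^star s_1 = 0 and s_2^star s_2 = e; but e is not in [J]. *)
      apply (J_conv_l _ (delta ([], [true]))) in H; [|apply is_l1_delta].
      rewrite (bop_sub _ _ _ _ (bop_conv_r _ _ (l1_le_delta ([], [true])))) in H
        by (try apply is_l1_conv; auto; apply is_l1_delta).
      rewrite <- conv_assoc, conv_unit_r in H by (auto; apply is_l1_delta).
      rewrite conv_delta in H. simpl in H. rewrite conv_zero_l in H by easy.
      apply (J_conv_r _ (delta ([true], []))) in H; [|apply is_l1_delta].
      rewrite (bop_sub _ _ _ _ (bop_conv_l _ _ (l1_le_delta ([true], [])))) in H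
        by (try apply is_l1_zero; apply is_l1_delta).
      rewrite conv_zero_l, conv_delta in H by apply is_l1_delta. simpl in H.
      apply (J_scale (- (1))%C) in H. apply not_J_unit.
      replace unit_A with (f_scale (- (1))%C (f_sub f_zero (delta ([], [])))); [easy|].
      extensionality t. unfold f_scale, f_sub, f_zero, unit_A, cu_e. ring.
  - intros a Ha HJ.
    destruct (classic (forall q, Phi q a = 0%C)) as [H|H].
    + now apply J_of_Phi in H.
    + apply not_all_ex_not in H as [q Hq].
      destruct (factor_unit q a Ha Hq) as [b [c [Hb [Hc E]]]].
      exists b, c. split; [easy|]. split; [easy|]. rewrite E, f_sub_diag. apply J_zero.
Qed.
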